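(* Let $a,b\in\mathbb{R}$, let $\alpha,\beta>-1$ and let $1<p\le q<\infty$. Let $$T^{+}f(z)=\int_{\mathcal{H}}\frac{f(w)}{|z-\bar{w}|^{1+b}}(\Im w)^a\, dV(w),\qquad z\in\mathcal{H}.$$ Then the following conditions are equivalent: (a) The operator $T^+$ is bounded from $L_{\alpha}^{p}(\mathcal{H})$ into $L_{\beta}^{q}(\mathcal{H})$. (b) The parameters satisfy $$b=a+1-\frac{\alpha+2}{p}+\frac{\beta+2}{q}\qquad\text{and}\qquad \alpha+1<p(a+1).$$
   Context: $\mathcal{H}=\{z=x+iy\in\mathbb{C}: y>0\}$ is the upper half-plane, $\Im w$ denotes the imaginary part of $w$, and $dV(x+iy)=dx\,dy$ is Lebesgue measure. For $\gamma\in\mathbb{R}$ and $1\le r<\infty$, $L^r_\gamma(\mathcal{H})=L^r(\mathcal{H},y^\gamma dx\,dy)$ is the space of measurable functions $f$ on $\mathcal{H}$ with $\|f\|_{r,\gamma}^r=\int_{\mathcal{H}}|f(x+iy)|^r y^\gamma\,dx\,dy<\infty$. *)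

(* Defs.v *)
From HB Require Import structures.
From mathcomp Require Import all_boot all_order all_algebra.
From mathcomp Require Import all_classical all_reals all_analysis.
From mathcomp Require Import complex.

Set Implicit Arguments.
Unset Strict Implicit.
Unset Printing Implicit Defensive.

Import Order.TTheory GRing.Theory Num.Theory.
Import numFieldNormedType.Exports.

Local Open Scope classical_set_scope.
Local Open Scope ring_scope.

Section UpperHalfPlane.
Context {R : realType}.

Local Notation plane := (measurableTypeR R * measurableTypeR R)%type.

(* The point z = x + iy of the plane is the pair (x, y), so that Im z = z.2;
   this gives the plane its Borel sigma-algebra and the product measure dx dy. *)
Definition upper_half_plane : set plane := [set z | (0 : R) < z.2].

Definition dV : {measure set plane -> \bar R} :=
  ((@lebesgue_measure R) \x (@lebesgue_measure R))%E.

Definition to_complex (z : plane) : R[i] := ((z.1 : R) +i* (z.2 : R))%C.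

Definition complex_modulus (c : R[i]) : R := ComplexField.Normc.normc c.

(* MathComp-Analysis puts no measurable structure on R[i] and has no integral
   of complex functions: both are taken componentwise. *)
Definition complex_measurable (D : set plane) (f : plane -> R[i]) : Prop :=
  measurable_fun D (fun z => complex.Re (f z)) /\
  measurable_fun D (fun z => complex.Im (f z)).

Definition complex_integrable (D : set plane) (f : plane -> R[i]) : Prop :=
  dV.-integrable D (fun z => (complex.Re (f z))%:E) /\
  dV.-integrable D (fun z => (complex.Im (f z))%:E).

Definition complex_integral (D : set plane) (f : plane -> R[i]) : R[i] :=
  (Rintegral dV D (fun z => complex.Re (f z)) +i*
   Rintegral dV D (fun z => complex.Im (f z)))%C.

Definition weighted_integral (r gamma : R) (f : plane -> R[i]) : \bar R :=
  (\int[dV]_(z in upper_half_plane)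
     (complex_modulus (f z) `^ r * (z.2 : R) `^ gamma)%:E)%E.

Definition weighted_Lnorm (r gamma : R) (f : plane -> R[i]) : \bar R :=
  (weighted_integral r gamma f `^ r^-1)%E.

Definition weighted_Lspace (r gamma : R) : set (plane -> R[i]) :=
  [set f | complex_measurable upper_half_plane f /\
           (weighted_integral r gamma f < +oo)%E].

Definition Tplus_integrand (a b : R) (f : plane -> R[i]) (z w : plane) : R[i] :=
  f w / ((complex_modulus (to_complex z - (to_complex w)^*%C) `^ (1 + b))%:C)%C
  * (((w.2 : R) `^ a)%:C)%C.

Definition Tplus (a b : R) (f : plane -> R[i]) (z : plane) : R[i] :=
  complex_integral upper_half_plane (Tplus_integrand a b f z).

(* Rintegral is total: it sends a divergent integral to a junk value (for
   instance an infinite one to 0). Hence the almost-everywhere absolute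
   convergence of the integral defining T^+ f is part of boundedness. *)
Definition Tplus_bounded (a b p alpha q beta : R) : Prop :=
  exists C : R, forall f : plane -> R[i], weighted_Lspace p alpha f ->
    [/\ {ae dV, forall z, upper_half_plane z ->
          complex_integrable upper_half_plane (Tplus_integrand a b f z)},
        weighted_Lspace q beta (Tplus a b f) &
        (weighted_Lnorm q beta (Tplus a b f)
           <= C%:E * weighted_Lnorm p alpha f)%E].

End UpperHalfPlane.

(* Main.v *)
Require Import Defs.
From HB Require Import structures.
From mathcomp Require Import all_boot all_order all_algebra.
From mathcomp Require Import all_classical all_reals all_analysis.
From mathcomp Require Import measurable_realfun complex ring lra.
Import Order.TTheory GRing.Theory Num.Theory.
Import numFieldNormedType.Exports.
Set Implicit Arguments.
Unset Strict Implicit.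
Unset Printing Implicit Defensive.
Local Open Scope classical_set_scope.
Local Open Scope ring_scope.

(** Write z = x + iy, w = u + iv, D = |z - conj w| and n = 1 + b.  Everything
    is governed by the homogeneity of the kernel D^(-n) v^a under dilations.

    Sufficiency is a Schur test with exponents p <= q ([schur_test]).  With
    s = (beta + 2)/q and t = a + 2 - (alpha + 2)/p the two conditions on the
    parameters say exactly that n = s + t and t > 1/p', where 1/p + 1/p' = 1,
    while beta > -1 says s > 1/q.  Splitting the kernel as D^(-nA) D^(-nB) with
    A + B = 1 and distributing the powers of v suitably
    ([schur_exponents]), both test integrals are instances of the estimate

      int v^m D^(-n) dV(w) <= C y^(m+2-n)       (m > -1, n > m + 2)

    ([integral_kernel_le]), which follows by comparing D with |x - u| + y + v
    and integrating first in u, then in v.  Thus the operator with the absolute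
    values inside is bounded ([positive_Tplus_bounded]); this gives at once the
    almost everywhere convergence of the integral defining T^+ f and the norm
    inequality ([Tplus_bounded_sufficient]).

    Necessity comes from testing boundedness on functions supported in
    rectangles, on which D is comparable to a constant ([test_inequality]).  The
    indicator of [0,t] x [t,2t] gives an inequality between two powers of t
    that holds for all t > 0, so the exponents agree: this is the formula for
    b.  If alpha + 1 >= p (a + 1), the function
    v^(-a-1) on [0,1] x [e^(-N),1] has norm at most N^(1/p), while its image
    is at least of order N on [0,1] x [1,2]; since p > 1 this fails for
    large N. *)

(** * Integration tools *)

(** Extension by zero off D1 x D2 reduces these statements to Tonelli's theorem
    on the whole product. *)
Section tonelli_on.
Context d1 d2 (T1 : measurableType d1) (T2 : measurableType d2) (R : realType).
Variables (m1 : {sigma_finite_measure set T1 -> \bar R})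
          (m2 : {sigma_finite_measure set T2 -> \bar R}).
Variables (D1 : set T1) (D2 : set T2) (f : T1 * T2 -> \bar R).
Hypotheses (mD1 : measurable D1) (mD2 : measurable D2)
  (mf : measurable_fun (D1 `*` D2) f)
  (f0 : forall z, (D1 `*` D2) z -> (0 <= f z)%E).
Local Open Scope ereal_scope.

Let mD : measurable (D1 `*` D2).
Proof. exact: measurableX. Qed.

Let mfD : measurable_fun [set: T1 * T2] (f \_ (D1 `*` D2)).
Proof. exact/(measurable_restrictT f). Qed.

Let fD0 z : 0 <= (f \_ (D1 `*` D2)) z.
Proof. exact: erestrict_ge0. Qed.

Let sectionF x : D1 x ->
  \int[m2]_y (f \_ (D1 `*` D2)) (x, y) = \int[m2]_(y in D2) f (x, y).
Proof.
move=> D1x; rewrite [RHS]integral_mkcond; apply: eq_integral => y _.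
rewrite !patchE; have [yD|yD] := boolP (y \in D2).
  by rewrite ifT // inE; split => //=; exact: set_mem.
by rewrite ifF//; apply/negP; rewrite inE => -[_ /mem_set]; exact/negP.
Qed.

Let sectionG y : D2 y ->
  \int[m1]_x (f \_ (D1 `*` D2)) (x, y) = \int[m1]_(x in D1) f (x, y).
Proof.
move=> D2y; rewrite [RHS]integral_mkcond; apply: eq_integral => x _.
rewrite !patchE; have [xD|xD] := boolP (x \in D1).
  by rewrite ifT // inE; split => //=; exact: set_mem.
by rewrite ifF//; apply/negP; rewrite inE => -[/mem_set + _]; exact/negP.
Qed.

Let emptyF x : ~ D1 x -> \int[m2]_y (f \_ (D1 `*` D2)) (x, y) = 0.
Proof.
move=> nD; rewrite integral0_eq// => y _.
by rewrite patchE ifF//; apply/negP; rewrite inE => -[].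
Qed.

Let emptyG y : ~ D2 y -> \int[m1]_x (f \_ (D1 `*` D2)) (x, y) = 0.
Proof.
move=> nD; rewrite integral0_eq// => x _.
by rewrite patchE ifF//; apply/negP; rewrite inE => -[].
Qed.

Let iterF : \int[m1]_x \int[m2]_y (f \_ (D1 `*` D2)) (x, y) =
  \int[m1]_(x in D1) \int[m2]_(y in D2) f (x, y).
Proof.
rewrite [RHS]integral_mkcond; apply: eq_integral => x _.
by rewrite patchE; case: ifPn => [/set_mem/sectionF|/negP xD] //;
  rewrite emptyF // => /mem_set.
Qed.

Let iterG : \int[m2]_y \int[m1]_x (f \_ (D1 `*` D2)) (x, y) =
  \int[m2]_(y in D2) \int[m1]_(x in D1) f (x, y).
Proof.
rewrite [RHS]integral_mkcond; apply: eq_integral => y _.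
by rewrite patchE; case: ifPn => [/set_mem/sectionG|/negP yD] //;
  rewrite emptyG // => /mem_set.
Qed.

Lemma tonelli_on : \int[m1]_(x in D1) \int[m2]_(y in D2) f (x, y) =
  \int[m2]_(y in D2) \int[m1]_(x in D1) f (x, y).
Proof. by rewrite -iterF -iterG; exact: (@fubini_tonelli _ _ _ _ _ m1 m2). Qed.

Lemma integral_prod_on : \int[m1 \x m2]_(z in D1 `*` D2) f z =
  \int[m2]_(y in D2) \int[m1]_(x in D1) f (x, y).
Proof. by rewrite integral_mkcond (fubini_tonelli2 _ mfD fD0) -iterG. Qed.

Lemma measurable_integral_on :
  measurable_fun D1 (fun x => \int[m2]_(y in D2) f (x, y)).
Proof.
apply: (eq_measurable_fun (fun x => \int[m2]_y (f \_ (D1 `*` D2)) (x, y))).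
  by move=> x /set_mem; exact: sectionF.
apply: measurable_funTS.
exact: (measurable_fun_fubini_tonelli_F (m2 := m2) _ mfD fD0).
Qed.

Lemma measurable_integral_on2 :
  measurable_fun D2 (fun y => \int[m1]_(x in D1) f (x, y)).
Proof.
apply: (eq_measurable_fun (fun y => \int[m1]_x (f \_ (D1 `*` D2)) (x, y))).
  by move=> y /set_mem; exact: sectionG.
apply: measurable_funTS.
exact: (measurable_fun_fubini_tonelli_G (m1 := m1) _ mfD fD0).
Qed.

End tonelli_on.

(** Hoelder's inequality on a measurable subset, obtained by extending both
    functions by zero. *)
Lemma hoelder_on d (T : measurableType d) (R : realType)
    (mu : {measure set T -> \bar R}) (D : set T) (f g : T -> R) (p q : R) :
  measurable D -> measurable_fun D f -> measurable_fun D g ->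
  (forall x, D x -> 0 <= f x) -> (forall x, D x -> 0 <= g x) ->
  0 < p -> 0 < q -> p^-1 + q^-1 = 1 ->
  (\int[mu]_(x in D) (f x * g x)%:E <=
   (\int[mu]_(x in D) (f x `^ p)%:E) `^ p^-1 *
   (\int[mu]_(x in D) (g x `^ q)%:E) `^ q^-1)%E.
Proof.
move=> mD mf mg f0 g0 p0 q0 pq.
have restrE (h : T -> R) r : 0 < r -> (forall x, D x -> 0 <= h x) ->
    (\int[mu]_x (`|((h \_ D) x)%:E| `^ r) = \int[mu]_(x in D) (h x `^ r)%:E)%E.
  move=> r0 h0; rewrite [RHS]integral_mkcond; apply: eq_integral => x _.
  rewrite !patchE; case: ifPn => [/set_mem Dx|_] /=.
    by rewrite ger0_norm ?h0.
  by rewrite normr0 powR0// gt_eqF.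
have := @hoelder _ T R mu (f \_ D) (g \_ D) p q _ _ p0 q0 pq.
rewrite Lnorm1 unlock /= !restrE//.
have -> : (\int[mu]_x `|((f \_ D \* g \_ D) x)%:E| =
           \int[mu]_(x in D) (f x * g x)%:E)%E.
  rewrite [RHS]integral_mkcond; apply: eq_integral => x _ /=.
  rewrite !patchE; case: ifPn => [/set_mem Dx|_] /=.
    by rewrite ger0_norm// mulr_ge0 ?f0 ?g0.
  by rewrite mul0r normr0.
by apply; [exact/(measurable_restrictT f)|exact/(measurable_restrictT g)].
Qed.

Lemma measurable_fun_section1 d1 d2 d3 (T1 : measurableType d1)
    (T2 : measurableType d2) (T3 : measurableType d3)
    (D1 : set T1) (D2 : set T2) (f : T1 * T2 -> T3) (x : T1) :
  measurable D1 -> measurable D2 -> measurable_fun (D1 `*` D2) f -> D1 x ->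
  measurable_fun D2 (fun y => f (x, y)).
Proof.
move=> mD1 mD2 mf D1x.
apply: (@measurable_comp _ _ _ _ _ _ (D1 `*` D2) f D2 (pair x)) => //.
- exact: measurableX.
- by move=> _ [y D2y <-].
- exact: measurable_funTS.
Qed.

Lemma measurable_fun_section2 d1 d2 d3 (T1 : measurableType d1)
    (T2 : measurableType d2) (T3 : measurableType d3)
    (D1 : set T1) (D2 : set T2) (f : T1 * T2 -> T3) (y : T2) :
  measurable D1 -> measurable D2 -> measurable_fun (D1 `*` D2) f -> D2 y ->
  measurable_fun D1 (fun x => f (x, y)).
Proof.
move=> mD1 mD2 mf D2y.
apply: (@measurable_comp _ _ _ _ _ _ (D1 `*` D2) f D1 (fun x => (x, y))) => //.
- exact: measurableX.
- by move=> _ [x D1x <-].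
- exact: measurable_funTS.
Qed.

Lemma measurable_powR_fun d (T : measurableType d) (R : realType) (D : set T)
    (f : T -> R) (r : R) :
  measurable_fun D f -> measurable_fun D (fun x => f x `^ r).
Proof. by move=> mf; apply: (measurableT_comp (measurable_powR r)). Qed.

(** Hoelder's inequality with exponents 1/t and 1/(1-t), written so that the
    degenerate case t = 1, which occurs for p = q in the Schur test, is
    included. *)
Lemma hoelder_interpolation d (T : measurableType d) (R : realType)
    (mu : {measure set T -> \bar R}) (D : set T) (f g : T -> R) (t : R) :
  measurable D -> measurable_fun D f -> measurable_fun D g ->
  (forall x, D x -> 0 <= f x) -> (forall x, D x -> 0 <= g x) ->
  0 < t <= 1 ->
  (\int[mu]_(x in D) (f x `^ t * g x `^ (1 - t))%:E <=
   (\int[mu]_(x in D) (f x)%:E) `^ t *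
   (\int[mu]_(x in D) (g x)%:E) `^ (1 - t))%E.
Proof.
move=> mD mf mg f0 g0 /andP[t0]; rewrite le_eqVlt => /orP[/eqP ->|t1].
  rewrite subrr poweRe0 mule1 poweRe1; last by apply: integral_ge0.
  rewrite le_eqVlt; apply/orP; left; apply/eqP; apply: eq_integral => x.
  by rewrite inE => Dx; rewrite powRr0 mulr1 powRr1// f0.
have t1' : 0 < 1 - t by rewrite subr_gt0.
have := @hoelder_on _ T R mu D (fun x => f x `^ t) (fun x => g x `^ (1 - t))
  t^-1 (1 - t)^-1 mD (measurable_powR_fun _ mf) (measurable_powR_fun _ mg).
rewrite !invrK !invr_gt0 => H.
have {}H := H (fun x _ => powR_ge0 _ _) (fun x _ => powR_ge0 _ _) t0 t1' (subrKC _ _).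
apply: (le_trans H); rewrite le_eqVlt; apply/orP; left; apply/eqP.
congr (_ `^ _ * _ `^ _)%E; apply: eq_integral => x; rewrite inE => Dx.
  by rewrite -powRrM mulfV ?gt_eqF// powRr1// f0.
by rewrite -powRrM mulfV ?gt_eqF// powRr1// g0.
Qed.

Lemma ge0_integral_setU_le d (T : measurableType d) (R : realType)
    (mu : {measure set T -> \bar R}) (A B : set T) (f : T -> \bar R) :
  measurable A -> measurable B -> measurable_fun (A `|` B) f ->
  (forall x, (A `|` B) x -> (0 <= f x)%E) ->
  (\int[mu]_(x in A `|` B) f x <=
   \int[mu]_(x in A) f x + \int[mu]_(x in B) f x)%E.
Proof.
move=> mA mB mf f0; have UE : A `|` B = A `|` (B `\` A).
  apply/seteqP; split => [x ABx|x [|[]]]; [|by left|by right].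
  by have [Ax|nAx] := pselect (A x); [left|right; case: ABx].
have mBA : measurable (B `\` A) by exact: measurableD.
rewrite UE ge0_integral_setU//; last 3 first.
- by rewrite -UE.
- by move=> x; rewrite -UE; exact: f0.
- by rewrite disj_set2E setDIK.
apply: leeD2l; apply: ge0_subset_integral => //.
- by apply: measurable_funS mf; [exact: measurableU|exact: subsetUr].
- by move=> x Bx; apply: f0; right.
Qed.

Lemma le_poweR (R : realType) (x y : \bar R) (r : R) :
  0 <= r -> (0 <= x)%E -> (x <= y)%E -> (x `^ r <= y `^ r)%E.
Proof.
move=> r0 x0 xy; apply: gt0_ler_poweR => //; rewrite in_itv/= leey andbT//.
exact: le_trans xy.
Qed.

(** * Integrals of powers on the line *)

Section one_dimensional.
Context {R : realType}.
Local Notation leb := (@lebesgue_measure R).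

Lemma powRE_gt0 (x r : R) : 0 < x -> x `^ r = expR (r * ln x).
Proof. by move=> x0; rewrite /powR gt_eqF. Qed.

Lemma integral_itv_primitive (f F : R -> R) (a b : R) : a < b ->
  (forall x, a <= x <= b -> is_derive x 1 F (f x) /\ {for x, continuous f}) ->
  (\int[leb]_(x in `[a, b]) (f x)%:E = (F b - F a)%:E)%E.
Proof.
move=> ab fF; rewrite EFinB.
have dF x : a <= x <= b -> derivable F x 1 by move=> /fF[[]].
apply: continuous_FTC2 => //.
- apply: continuous_in_subspaceT => x; rewrite inE/= in_itv/= => xab.
  by have [] := fF x xab.
- have cF : {within `[a, b]%classic, continuous F}.
    by apply: derivable_within_continuous => x; rewrite in_itv/= => /dF.
  have /(continuous_within_itvP _ ab)[_ ? ?] := cF.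
  split => // x; rewrite in_itv/= => /andP[/ltW ax /ltW xb].
  by apply: dF; rewrite ax.
- move=> x; rewrite in_itv/= => /andP[/ltW ax /ltW xb].
  have [dFx _] := fF x (introT andP (conj ax xb)).
  by rewrite derive1E; exact: derive_val.
Qed.

(** Exhausting by segments makes the fundamental theorem of calculus apply to
    half-lines and to singularities at an end point, with only a bound on the
    increments of the primitive. *)
Lemma integral_le_primitive (f F : R -> R) (a b : nat -> R) (M : R) :
  (forall k, a k < b k) -> nonincreasing_seq a -> nondecreasing_seq b ->
  (forall k x, a k <= x <= b k ->
    [/\ 0 <= f x, is_derive x 1 F (f x) & {for x, continuous f}]) ->
  (forall k, F (b k) - F (a k) <= M) ->
  (\int[leb]_(x in \bigcup_k `[a k, b k]%classic) (f x)%:E <= M%:E)%E.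
Proof.
move=> ab da ib fF FM.
have nd : nondecreasing_seq (fun k => `[a k, b k]%classic).
  move=> m n mn; rewrite subsetEset; apply: subset_itv; rewrite bnd_simp.
    exact: da.
  exact: ib.
have mf k : measurable_fun (`[a k, b k]%classic : set (measurableTypeR R))
    (EFin \o f).
  apply/measurable_EFinP; apply: subspace_continuous_measurable_fun => //.
  apply: continuous_in_subspaceT => x; rewrite inE/= in_itv/= => xab.
  by have [] := fF k x xab.
have f0 k (x : measurableTypeR R) :
    `[a k, b k]%classic x -> (0 <= (EFin \o f) x)%E.
  by rewrite /= in_itv/= lee_fin => /fF[].
have cvgI := @ge0_nondecreasing_set_cvg_integral _ (measurableTypeR R) R
  _ _ leb nd (fun=> measurable_itv _) mf f0.
rewrite -(cvg_lim _ cvgI)//; apply: lime_le; first exact: cvgP cvgI.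
apply: nearW => k /=; rewrite (@integral_itv_primitive _ F) ?lee_fin//.
by move=> x /fF[].
Qed.

Lemma ler_powRN (x y r : R) : 0 < x -> x <= y -> r <= 0 -> y `^ r <= x `^ r.
Proof.
move=> x0 xy r0; have y0 := lt_le_trans x0 xy.
by rewrite !powRE_gt0// ler_expR ler_wnM2l// ler_ln.
Qed.

Lemma is_derive_powR_div (c k x : R) : k + 1 != 0 -> 0 < x + c ->
  is_derive x 1 (fun u => (u + c) `^ (k + 1) / (k + 1)) ((x + c) `^ k).
Proof.
move=> k1 xc.
have dD : is_derive x 1 (fun u : R => u + c) 1.
  by apply: is_derive_eq; rewrite addr0.
have := @is_derive1_comp R (fun u => u `^ (k + 1)) (fun u => u + c) x _ _
  (is_derive1_powR (k + 1) xc) dD.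
rewrite mulr1 addrK => dP.
have -> : (fun u => (u + c) `^ (k + 1) / (k + 1)) =
   (k + 1)^-1 *: (fun u => (u + c) `^ (k + 1)) :> (R -> R).
  by apply/funext => u /=; rewrite /GRing.scale /= mulrC.
by apply: is_derive_eq; rewrite /GRing.scale /= mulrA mulVf// mul1r.
Qed.

Lemma continuous_powR_shift (c k x : R) : 0 < x + c ->
  {for x, continuous (fun u => (u + c) `^ k)}.
Proof.
move=> xc; apply/differentiable_continuous/derivable1_diffP.
have dD : is_derive x 1 (fun u : R => u + c) 1.
  by apply: is_derive_eq; rewrite addr0.
by have [] := @is_derive1_comp R (fun u => u `^ k) (fun u => u + c) x _ _
  (is_derive1_powR k xc) dD.
Qed.

Lemma integral_powR_tail (k a c : R) : k < -1 -> 0 < a + c ->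
  (\int[leb]_(x in `[a, +oo[) ((x + c) `^ k)%:E <=
   ((a + c) `^ (k + 1) / - (k + 1))%:E)%E.
Proof.
move=> k1 ac; have k10 : k + 1 < 0 by lra.
rewrite (_ : `[a, +oo[%classic = \bigcup_i `[a, a + i.+1%:R]%classic); last first.
  apply/seteqP; split => x /=; rewrite ?in_itv/= ?andbT.
    move=> ax; exists (Num.truncn (x - a)) => //=; rewrite in_itv/= ax/=.
    by rewrite -lerBlDl ltW// truncnS_gt.
  by move=> [i _ /=]; rewrite in_itv/= => /andP[].
apply: (@integral_le_primitive _ (fun u => (u + c) `^ (k + 1) / (k + 1))).
- by move=> i; rewrite ltrDl.
- by [].
- by move=> i j ij; rewrite lerD2l ler_nat.
- move=> i x /andP[ax _]; have xc : 0 < x + c by lra.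
  split; first exact: powR_ge0.
  - by apply: is_derive_powR_div => //; rewrite lt_eqF.
  - exact: continuous_powR_shift.
- move=> i; rewrite invrN mulrN.
  have : (a + i.+1%:R + c) `^ (k + 1) / (k + 1) <= 0.
    by rewrite mulr_ge0_le0 ?powR_ge0// invr_le0 ltW.
  lra.
Qed.

Lemma integral_powR_head (m y : R) : -1 < m -> 0 < y ->
  (\int[leb]_(x in `]0%R, y]) (x `^ m)%:E <= (y `^ (m + 1) / (m + 1))%:E)%E.
Proof.
move=> m1 y0; have m10 : 0 < m + 1 by lra.
(* Dividing by i + 2, not i + 1, keeps the segments nondegenerate. *)
rewrite (_ : `]0%R, y]%classic = \bigcup_i `[y / i.+2%:R, y]%classic); last first.
  apply/seteqP; split => x /=; rewrite ?in_itv/=.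
    move=> /andP[x0 xy]; exists (Num.truncn (y / x)) => //=; rewrite in_itv/= xy andbT.
    rewrite ler_pdivrMr// mulrC -ler_pdivrMr//.
    by rewrite (le_trans (ltW (truncnS_gt _)))// ler_nat.
  move=> [i _ /=]; rewrite in_itv/= => /andP[ix ->]; rewrite andbT.
  by rewrite (lt_le_trans _ ix)// divr_gt0.
(* The zero shift gives the primitive the shape of [is_derive_powR_div]. *)
apply: (@integral_le_primitive _ (fun u => (u + 0) `^ (m + 1) / (m + 1))).
- by move=> i; rewrite ltr_pdivrMr// ltr_pMr// ltr1n.
- by move=> i j ij; rewrite ler_pM2l// lef_pV2 ?posrE// ler_nat.
- by [].
- move=> i x /andP[ix _]; have x0 : 0 < x by rewrite (lt_le_trans _ ix)// divr_gt0.
  split; first exact: powR_ge0.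
    by have := @is_derive_powR_div 0 m x; rewrite addr0; apply => //; rewrite gt_eqF.
  have := @continuous_powR_shift 0 m x; rewrite addr0.
  by rewrite (_ : (fun u => (u + 0) `^ m) = @powR R ^~ m);
    [exact|apply/funext => u; rewrite addr0].
- move=> i; rewrite !addr0; have : 0 <= (y / i.+2%:R) `^ (m + 1) / (m + 1).
    by rewrite divr_ge0 ?powR_ge0// ltW.
  lra.
Qed.

(** Reflecting the left half-line reduces it to the right one. *)
Lemma integral_powR_line (k x s : R) : k < -1 -> 0 < s ->
  (\int[leb]_(u in [set: R]) ((`|x - u| + s) `^ k)%:E <=
   (2 / - (k + 1) * s `^ (k + 1))%:E)%E.
Proof.
move=> k1 s0.
have right (a : R) : (\int[leb]_(u in `[a, +oo[) ((`|a - u| + s) `^ k)%:E <=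
   (s `^ (k + 1) / - (k + 1))%:E)%E.
  have := @integral_powR_tail k a (s - a) k1; rewrite addrC subrK => /(_ s0).
  apply: le_trans; rewrite le_eqVlt; apply/orP; left; apply/eqP.
  apply: eq_integral => u; rewrite inE/= in_itv/= andbT => au.
  by rewrite ler0_norm ?subr_le0// opprB; congr (_ `^ _)%:E; ring.
have mf : measurable_fun [set: measurableTypeR R]
    (fun u : measurableTypeR R => ((`|x - u| + s) `^ k)%:E).
  apply/measurable_EFinP; apply: (measurableT_comp (measurable_powR _)).
  apply: measurable_funD => //; apply: measurableT_comp => //.
  exact: measurable_funB.
have cf : continuous (fun u : R => (`|x - u| + s) `^ k).
  move=> u; have -> : (fun u : R => (`|x - u| + s) `^ k) =
     (fun t => (t + s) `^ k) \o (fun u : R => `|x - u|) by [].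
  apply: continuous_comp; last by apply: continuous_powR_shift; rewrite ltr_wpDl.
  by apply: cvg_norm; apply: cvgB; [exact: cvg_cst|exact: cvg_id].
have left : (\int[leb]_(u in `]-oo, x]) ((`|x - u| + s) `^ k)%:E <=
   (s `^ (k + 1) / - (k + 1))%:E)%E.
  have := @ge0_integration_by_substitutionNy R (fun u => (`|x - u| + s) `^ k) (- x).
  rewrite opprK => ->.
  - apply: le_trans (right (- x)); rewrite le_eqVlt; apply/orP; left; apply/eqP.
    by apply: eq_integral => u _ /=; rewrite opprK -opprD normrN.
  - exact: continuous_subspaceT.
  - by move=> u _; exact: powR_ge0.
have UT : [set: R] = `]-oo, x]%classic `|` `[x, +oo[%classic.
  apply/seteqP; split => // u _ /=; rewrite !in_itv/= andbT.
  by case: (leP u x) => [|/ltW]; [left|right].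
rewrite UT; apply: (le_trans (ge0_integral_setU_le _ _ _ _ _)) => //.
- by rewrite -UT.
- by move=> u _; rewrite lee_fin powR_ge0.
apply: (le_trans (leeD left (right x))).
by rewrite -EFinD lee_fin le_eqVlt; apply/orP; left; apply/eqP; ring.
Qed.

(** Below y the factor (v + y)^k is at most y^k and v^m is integrable at 0;
    above y it is at most v^k and v^(m+k) is integrable at infinity. *)
Lemma integral_powR_halfline (m k y : R) : -1 < m -> m + k < -1 -> 0 < y ->
  (\int[leb]_(v in `]0%R, +oo[) (v `^ m * (v + y) `^ k)%:E <=
   (((m + 1)^-1 + (- (m + k + 1))^-1) * y `^ (m + k + 1))%:E)%E.
Proof.
move=> m1 mk y0; have k0 : k <= 0 by lra.
have mf : measurable_fun [set: measurableTypeR R]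
    (fun v : measurableTypeR R => (v `^ m * (v + y) `^ k)%:E).
  apply/measurable_EFinP; apply: measurable_funM; first exact: measurable_powR.
  by apply: (measurableT_comp (measurable_powR _)); exact: measurable_funD.
have mp (r : R) : measurable_fun [set: measurableTypeR R]
     (fun v : measurableTypeR R => (v `^ r)%:E).
  by apply/measurable_EFinP; exact: measurable_powR.
have near0 : (\int[leb]_(v in `]0%R, y]) (v `^ m * (v + y) `^ k)%:E <=
    (y `^ (m + k + 1) / (m + 1))%:E)%E.
  have -> : y `^ (m + k + 1) / (m + 1) = y `^ k * (y `^ (m + 1) / (m + 1)).
    rewrite mulrA -powRD; last by apply/implyP => _; rewrite gt_eqF.
    by congr (_ `^ _ / _); ring.
  rewrite EFinM (le_trans _ (lee_wpmul2l _ (integral_powR_head m1 y0)))//; last first.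
    by rewrite lee_fin powR_ge0.
  rewrite -ge0_integralZl_EFin ?powR_ge0//; last 2 first.
  - by move=> v _; rewrite lee_fin powR_ge0.
  - exact: measurable_funTS.
  apply: ge0_le_integral => //.
  - by move=> v _; rewrite lee_fin mulr_ge0 ?powR_ge0.
  - exact: measurable_funTS.
  - by apply: emeasurable_funM; [exact: measurable_cst|exact: measurable_funTS].
  - move=> v /=; rewrite in_itv/= => /andP[v0 _].
    rewrite -EFinM lee_fin mulrC ler_wpM2r ?powR_ge0//.
    by apply: ler_powRN => //; rewrite lerDr ltW.
have far : (\int[leb]_(v in `[y, +oo[) (v `^ m * (v + y) `^ k)%:E <=
    (y `^ (m + k + 1) / - (m + k + 1))%:E)%E.
  have := @integral_powR_tail (m + k) y 0; rewrite addr0 => /(_ mk y0).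
  apply: le_trans; apply: ge0_le_integral => //.
  - by move=> v _; rewrite lee_fin mulr_ge0 ?powR_ge0.
  - exact: measurable_funTS.
  - apply: (eq_measurable_fun (fun v : measurableTypeR R => (v `^ (m + k))%:E)).
      by move=> v _; rewrite addr0.
    exact: measurable_funTS.
  - move=> v /=; rewrite in_itv/= andbT addr0 => yv.
    have v0 := lt_le_trans y0 yv.
    rewrite lee_fin powRD; last by apply/implyP => _; rewrite gt_eqF.
    by rewrite ler_wpM2l ?powR_ge0// ler_powRN// lerDl ltW.
have UE : `]0%R, +oo[%classic = `]0%R, y]%classic `|` `[y, +oo[%classic.
  apply/seteqP; split => v /=; rewrite !in_itv/= !andbT.
    by move=> v0; case: (leP v y) => [|/ltW]; [left; rewrite v0|right].
  by move=> [/andP[]//|]; exact: lt_le_trans.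
rewrite UE; apply: (le_trans (ge0_integral_setU_le _ _ _ _ _)) => //.
- exact: measurable_funTS.
- by move=> u _; rewrite lee_fin mulr_ge0 ?powR_ge0.
apply: (le_trans (leeD near0 far)).
rewrite -EFinD lee_fin le_eqVlt; apply/orP; left; apply/eqP.
by rewrite mulrDl ![y `^ _ * _]mulrC.
Qed.

End one_dimensional.

(** * A Schur test from L^p to L^q *)

(** The kernel is given as a product P1 P2 and phi is the weight of the test.
    Two applications of Hoelder's inequality bound the q-th power of the image
    of g at x by phi(x)^q times the integral of P2(x,.)^q g^p; the second test
    condition, with Tonelli's theorem, then integrates this in x.  The
    inequality p <= q serves to interpolate P2^p g^p between P2^q g^p and
    g^p. *)
Section schur.
Context d1 d2 (T1 : measurableType d1) (T2 : measurableType d2) (R : realType).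
Variables (m1 : {sigma_finite_measure set T1 -> \bar R})
          (m2 : {sigma_finite_measure set T2 -> \bar R}).
Variables (D1 : set T1) (D2 : set T2) (P1 P2 : T1 * T2 -> R).
Variables (g : T2 -> R) (phi : T1 -> R) (p q C1 C2 : R).
Hypotheses (p1 : 1 < p) (pq : p <= q) (C10 : 0 <= C1) (C20 : 0 <= C2).
Hypotheses (mD1 : measurable D1) (mD2 : measurable D2).
Hypotheses (mP1 : measurable_fun (D1 `*` D2) P1)
  (mP2 : measurable_fun (D1 `*` D2) P2)
  (mg : measurable_fun D2 g) (mphi : measurable_fun D1 phi).
Hypotheses (P10 : forall z, (D1 `*` D2) z -> 0 <= P1 z)
  (P20 : forall z, (D1 `*` D2) z -> 0 <= P2 z)
  (g0 : forall y, D2 y -> 0 <= g y) (phi0 : forall x, D1 x -> 0 <= phi x).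
Let p' := p / (p - 1).
Hypothesis test1 : forall x, D1 x ->
  (\int[m2]_(y in D2) (P1 (x, y) `^ p')%:E <= (C1 * phi x `^ p')%:E)%E.
Hypothesis test2 : forall y, D2 y ->
  (\int[m1]_(x in D1) ((phi x * P2 (x, y)) `^ q)%:E <= C2%:E)%E.
Local Open Scope ereal_scope.

Let N := \int[m2]_(y in D2) (g y `^ p)%:E.
Let S x := \int[m2]_(y in D2) (P2 (x, y) `^ q * g y `^ p)%:E.

Let p0 : (0 < p)%R. Proof. exact: lt_trans p1. Qed.
Let q0 : (0 < q)%R. Proof. exact: lt_le_trans pq. Qed.
Let p'0 : (0 < p')%R. Proof. by rewrite divr_gt0// subr_gt0. Qed.
Let pp' : (p'^-1 + p^-1 = 1)%R.
Proof. by rewrite /p'; field; rewrite !gt_eqF// subr_gt0. Qed.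

Let mg2 : measurable_fun (D1 `*` D2) (fun z => g z.2).
Proof.
apply: (@measurable_comp _ _ _ _ _ _ D2 g (D1 `*` D2) snd) => //.
- by move=> _ [z [_ ?] <-].
- exact: measurable_funTS.
Qed.

Let mphi1 : measurable_fun (D1 `*` D2) (fun z => phi z.1).
Proof.
apply: (@measurable_comp _ _ _ _ _ _ D1 phi (D1 `*` D2) fst) => //.
- by move=> _ [z [? _] <-].
- exact: measurable_funTS.
Qed.

Let N0 : 0 <= N.
Proof. by apply: integral_ge0 => y _; rewrite lee_fin powR_ge0. Qed.

Let S0 x : 0 <= S x.
Proof. by apply: integral_ge0 => y _; rewrite lee_fin mulr_ge0 ?powR_ge0. Qed.

Let schur_pointwise x : D1 x ->
  (\int[m2]_(y in D2) (P1 (x, y) * P2 (x, y) * g y)%:E) `^ q <=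
  (C1 `^ (q / p'))%:E * N `^ (q / p - 1) * ((phi x `^ q)%:E * S x).
Proof.
move=> D1x.
have mP1x := measurable_fun_section1 mD1 mD2 mP1 D1x.
have mP2x := measurable_fun_section1 mD1 mD2 mP2 D1x.
have P10x y : D2 y -> (0 <= P1 (x, y))%R by move=> D2y; exact: P10.
have P20x y : D2 y -> (0 <= P2 (x, y))%R by move=> D2y; exact: P20.
have I0 : 0 <= \int[m2]_(y in D2) (P1 (x, y) * P2 (x, y) * g y)%:E.
  by apply: integral_ge0 => y D2y; rewrite lee_fin !mulr_ge0 ?P10x ?P20x ?g0.
have first_hoelder : \int[m2]_(y in D2) (P1 (x, y) * P2 (x, y) * g y)%:E <=
    (C1 `^ p'^-1 * phi x)%:E *
    (\int[m2]_(y in D2) ((P2 (x, y) * g y) `^ p)%:E) `^ p^-1.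
  have := @hoelder_on _ T2 R m2 D2 (fun y => P1 (x, y))
    (fun y => P2 (x, y) * g y)%R p' p mD2 mP1x (measurable_funM mP2x mg) P10x
    (fun y D2y => mulr_ge0 (P20x y D2y) (g0 D2y)) p'0 p0 pp'.
  under eq_integral do rewrite mulrA.
  move/le_trans; apply; apply: lee_wpmul2r; first exact: poweR_ge0.
  have -> : (C1 `^ p'^-1 * phi x)%:E = (C1 * phi x `^ p')%:E `^ p'^-1.
    rewrite poweR_EFin powRM ?powR_ge0// -powRrM mulfV ?gt_eqF//.
    by rewrite powRr1// phi0.
  apply: le_poweR; first by rewrite invr_ge0 ltW.
    by apply: integral_ge0 => y _; rewrite lee_fin powR_ge0.
  exact: test1.
have second_hoelder : \int[m2]_(y in D2) ((P2 (x, y) * g y) `^ p)%:E <=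
    S x `^ (p / q) * N `^ (1 - p / q).
  have := @hoelder_interpolation _ T2 R m2 D2
    (fun y => P2 (x, y) `^ q * g y `^ p)%R (fun y => g y `^ p)%R (p / q) mD2.
  move=> /(_ (measurable_funM (measurable_powR_fun _ mP2x) (measurable_powR_fun _ mg))).
  move=> /(_ (measurable_powR_fun _ mg)).
  move=> /(_ (fun y _ => mulr_ge0 (powR_ge0 _ _) (powR_ge0 _ _))).
  move=> /(_ (fun y _ => powR_ge0 _ _)).
  rewrite divr_gt0// ler_pdivrMr// mul1r pq => /(_ isT).
  apply: le_trans; rewrite le_eqVlt; apply/orP; left; apply/eqP.
  apply: eq_integral => y; rewrite inE => D2y.
  rewrite powRM ?P20x ?g0// [in RHS]powRM ?powR_ge0// -!powRrM.
  rewrite -mulrA -powRD; last first.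
    by apply/implyP; rewrite -mulrDr addrC subrK mulr1 gt_eqF.
  congr (_ `^ _ * _ `^ _)%:E; first by rewrite mulrCA mulfV ?mulr1// gt_eqF.
  by rewrite -mulrDr addrC subrK mulr1.
have q0' : (0 <= q)%R by exact: ltW.
apply: (le_trans (le_poweR q0' I0 first_hoelder)).
rewrite poweRM ?poweR_ge0//; last by rewrite lee_fin mulr_ge0 ?powR_ge0 ?phi0.
rewrite poweR_EFin powRM ?powR_ge0 ?phi0// -powRrM -poweRrM.
have K : (\int[m2]_(y in D2) ((P2 (x, y) * g y) `^ p)%:E) `^ (p^-1 * q) <=
    S x * N `^ (q / p - 1).
  have pq0 : (0 <= p^-1 * q)%R by rewrite mulr_ge0// ltW ?invr_gt0.
  apply: (le_trans (le_poweR pq0 _ second_hoelder)).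
    by apply: integral_ge0 => y _; rewrite lee_fin powR_ge0.
  rewrite poweRM ?poweR_ge0// -!poweRrM.
  have -> : (p / q * (p^-1 * q) = 1)%R by field; rewrite !gt_eqF.
  rewrite poweRe1//.
  by have -> : ((1 - p / q) * (p^-1 * q) = q / p - 1)%R by field; rewrite !gt_eqF.
rewrite EFinM (mulrC _ q).
apply: (le_trans (lee_wpmul2l _ K)); first by rewrite lee_fin mulr_ge0 ?powR_ge0.
rewrite le_eqVlt; apply/orP; left; apply/eqP.
by rewrite -!muleA [N `^ _ * _]muleCA [N `^ _ * _]muleC.
Qed.

Lemma schur_test :
  \int[m1]_(x in D1) (\int[m2]_(y in D2) (P1 (x, y) * P2 (x, y) * g y)%:E) `^ q <=
  (C1 `^ (q / p') * C2)%:E * (\int[m2]_(y in D2) (g y `^ p)%:E) `^ (q / p).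
Proof.
have mSq : measurable_fun (D1 `*` D2)
    (fun z => (P2 z `^ q * g z.2 `^ p)%:E).
  apply/measurable_EFinP.
  by apply: measurable_funM; exact: measurable_powR_fun.
have mS : measurable_fun D1 S.
  apply: (measurable_integral_on m2 mD1 mD2 mSq).
  by move=> z _; rewrite lee_fin mulr_ge0 ?powR_ge0.
have mI : measurable_fun D1
    (fun x => \int[m2]_(y in D2) (P1 (x, y) * P2 (x, y) * g y)%:E).
  apply: (measurable_integral_on m2
    (f := fun z => (P1 z * P2 z * g z.2)%:E) mD1 mD2).
    by apply/measurable_EFinP; apply: measurable_funM => //; exact: measurable_funM.
  by move=> z [? ?]; rewrite lee_fin !mulr_ge0 ?P10 ?P20 ?g0.
have mphiS : measurable_fun D1 (fun x => (phi x `^ q)%:E * S x).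
  apply: emeasurable_funM => //; apply/measurable_EFinP.
  exact: measurable_powR_fun.
have phiS0 x : 0 <= (phi x `^ q)%:E * S x by rewrite mule_ge0// lee_fin powR_ge0.
have NC0 : 0 <= (C1 `^ (q / p'))%:E * N `^ (q / p - 1).
  by rewrite mule_ge0 ?poweR_ge0// lee_fin powR_ge0.
apply: (@le_trans _ _ (\int[m1]_(x in D1)
    ((C1 `^ (q / p'))%:E * N `^ (q / p - 1) * ((phi x `^ q)%:E * S x)))).
  apply: ge0_le_integral => //.
  - by move=> x _; exact: poweR_ge0.
  - by apply: (measurableT_comp (measurable_poweR q)).
  - exact: emeasurable_funM.
rewrite ge0_integralZl//.
have swap : \int[m1]_(x in D1) ((phi x `^ q)%:E * S x) <= C2%:E * N.
  have -> : \int[m1]_(x in D1) ((phi x `^ q)%:E * S x) =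
     \int[m1]_(x in D1) \int[m2]_(y in D2)
       (((phi x * P2 (x, y)) `^ q * g y `^ p)%:E).
    apply: eq_integral => x; rewrite inE => D1x.
    rewrite -ge0_integralZl_EFin ?powR_ge0//; last 2 first.
    - by move=> y _; rewrite lee_fin mulr_ge0 ?powR_ge0.
    - exact: (measurable_fun_section1 mD1 mD2 mSq D1x).
    apply: eq_integral => y; rewrite inE => D2y.
    by rewrite -EFinM mulrA powRM ?P20 ?phi0.
  have mPhi : measurable_fun (D1 `*` D2)
      (fun z => ((phi z.1 * P2 z) `^ q)%:E).
    apply/measurable_EFinP; apply: measurable_powR_fun.
    exact: measurable_funM.
  have mphiPg : measurable_fun (D1 `*` D2)
      (fun z => ((phi z.1 * P2 z) `^ q * g z.2 `^ p)%:E).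
    apply/measurable_EFinP; apply: measurable_funM; last exact: measurable_powR_fun.
    exact/measurable_EFinP.
  rewrite (tonelli_on m1 m2 (f := fun z => ((phi z.1 * P2 z) `^ q * g z.2 `^ p)%:E))//; last first.
  - by move=> z _; rewrite lee_fin mulr_ge0 ?powR_ge0.
  rewrite -ge0_integralZl_EFin//; last 2 first.
  - by move=> y _; rewrite lee_fin powR_ge0.
  - by apply/measurable_EFinP; exact: measurable_powR_fun.
  apply: ge0_le_integral => //.
  - by move=> y _; apply: integral_ge0 => x _; rewrite lee_fin mulr_ge0 ?powR_ge0.
  - apply: (measurable_integral_on2 m1 mD1 mD2 mphiPg).
    by move=> z _; rewrite lee_fin mulr_ge0 ?powR_ge0.
  - apply: emeasurable_funM => //.
    by apply/measurable_EFinP; exact: measurable_powR_fun.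
  - move=> y D2y /=; under eq_integral do rewrite EFinM muleC.
    rewrite ge0_integralZl_EFin ?powR_ge0//; last 2 first.
    + by move=> x _; rewrite lee_fin powR_ge0.
    + exact: (measurable_fun_section2 mD1 mD2 mPhi D2y).
    by rewrite muleC lee_wpmul2r ?test2// lee_fin powR_ge0.
apply: (le_trans (lee_wpmul2l NC0 swap)).
rewrite le_eqVlt; apply/orP; left; apply/eqP.
rewrite EFinM -!muleA; congr (_ * _); rewrite muleCA; congr (_ * _).
rewrite -[X in _ * X](poweRe1 N0) -poweRD; first by rewrite subrK.
by apply: add_neq0_poweRD_def; rewrite subrK gt_eqF// divr_gt0.
Qed.
End schur.

(** * The kernel of the upper half-plane *)

Section upper_half_plane.
Context {R : realType}.
Local Notation plane := (measurableTypeR R * measurableTypeR R)%type.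
Local Notation leb := (@lebesgue_measure R).
Local Notation H := (@upper_half_plane R).
Local Notation dV := (@dV R).

(** The measure [dV] is packaged without its sigma-finiteness, on which
    Tonelli's theorem rests; [area] is the same set function and carries it. *)
Definition area : set plane -> \bar R := (leb \x leb)%E.

HB.instance Definition _ := Measure.copy area dV.

Lemma sigma_finite_area : sigma_finite [set: plane] area.
Proof.
pose I (n : nat) : set (measurableTypeR R) := `[- n%:R, n%:R]%classic.
exists (fun n => I n `*` I n).
  apply/seteqP; split => // -[x y] _.
  exists (maxn (Num.bound `|x : R|) (Num.bound `|y : R|)) => //=.
  have inI (t : R) n : (Num.bound `|t| <= n)%N -> `[- n%:R, n%:R]%classic t.
    move=> tn; rewrite /= in_itv/= -ler_norml ltW//.
    by rewrite (lt_le_trans (archi_boundP (normr_ge0 t)))// ler_nat.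
  by split => /=; apply: inI; rewrite ?leq_maxl ?leq_maxr.
move=> n; split; first by apply: measurableX; exact: measurable_itv.
rewrite /area product_measure1E; [|exact: measurable_itv|exact: measurable_itv].
have muI : (leb (I n) < +oo)%E.
  by rewrite /I lebesgue_measure_itv/=; case: ifP => _; rewrite ?ltry// -EFinD ltry.
by rewrite lte_mul_pinfty// ge0_fin_numE.
Qed.

HB.instance Definition _ :=
  Measure_isSigmaFinite.Build _ plane R area sigma_finite_area.

Definition reflected_dist (z w : plane) : R :=
  complex_modulus (to_complex z - (to_complex w)^*%C).

Lemma reflected_distE (z w : plane) : reflected_dist z w =
  Num.sqrt (((z.1 : R) - w.1) ^+ 2 + ((z.2 : R) + w.2) ^+ 2).
Proof. by rewrite /reflected_dist /complex_modulus /= opprK. Qed.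

Lemma reflected_distC (z w : plane) : reflected_dist z w = reflected_dist w z.
Proof.
rewrite !reflected_distE; congr Num.sqrt; rewrite [in RHS]addrC; ring.
Qed.

Lemma reflected_dist_ge (z w : plane) : H z -> H w ->
  `|(z.1 : R) - w.1| + ((z.2 : R) + w.2) <= 2 * reflected_dist z w.
Proof.
rewrite /upper_half_plane /= => z0 w0; rewrite reflected_distE.
set x : R := _ - _; set y : R := _ + _; have y0 : 0 <= y by rewrite addr_ge0// ltW.
have hx : `|x| <= Num.sqrt (x ^+ 2 + y ^+ 2).
  by rewrite -sqrtr_sqr ler_wsqrtr// lerDl sqr_ge0.
have hy : y <= Num.sqrt (x ^+ 2 + y ^+ 2).
  by rewrite -[leLHS]ger0_norm// -sqrtr_sqr ler_wsqrtr// lerDr sqr_ge0.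
by rewrite mulr_natl mulr2n lerD.
Qed.

Lemma reflected_dist_le (z w : plane) : H z -> H w ->
  reflected_dist z w <= `|(z.1 : R) - w.1| + ((z.2 : R) + w.2).
Proof.
rewrite /upper_half_plane /= => z0 w0; rewrite reflected_distE.
set x : R := _ - _; set y : R := _ + _; have y0 : 0 <= y by rewrite addr_ge0// ltW.
rewrite -[leRHS]ger0_norm; last exact: addr_ge0.
rewrite -sqrtr_sqr ler_wsqrtr//.
by rewrite -(real_normK (num_real x)) [leRHS]sqrrD lerD2r lerDl mulrn_wge0// mulr_ge0.
Qed.

Lemma reflected_dist_gt0 (z w : plane) : H z -> H w -> 0 < reflected_dist z w.
Proof.
move=> z0 w0; have := reflected_dist_ge z0 w0.
rewrite /upper_half_plane /= in z0 w0.
have : 0 <= `|(z.1 : R) - w.1| by [].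
have : 0 < (z.2 : R) + w.2 by rewrite addr_gt0.
move: (`|_|) (_ + w.2) => u v; lra.
Qed.

Lemma measurable_reflected_dist :
  measurable_fun [set: plane * plane] (fun zw => reflected_dist zw.1 zw.2).
Proof.
under eq_fun do rewrite reflected_distE -powR12_sqrt ?addr_ge0 ?sqr_ge0//.
apply: measurable_powR_fun.
have m1 : measurable_fun [set: plane * plane] (fun zw => zw.1.1 : R).
  by apply: (measurableT_comp (measurable_fst : measurable_fun _ (fst : plane -> R))).
have m2 : measurable_fun [set: plane * plane] (fun zw => zw.1.2 : R).
  by apply: (measurableT_comp (measurable_snd : measurable_fun _ (snd : plane -> R))).
have m3 : measurable_fun [set: plane * plane] (fun zw => zw.2.1 : R).
  by apply: (measurableT_comp (measurable_fst : measurable_fun _ (fst : plane -> R))).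
have m4 : measurable_fun [set: plane * plane] (fun zw => zw.2.2 : R).
  by apply: (measurableT_comp (measurable_snd : measurable_fun _ (snd : plane -> R))).
apply: measurable_funD; apply: measurable_funX.
  exact: measurable_funB.
exact: measurable_funD.
Qed.

Lemma measurable_im : measurable_fun [set: plane] (fun z : plane => z.2 : R).
Proof. exact: measurable_snd. Qed.

Lemma upper_half_planeE : H = [set: measurableTypeR R] `*` `]0%R, +oo[%classic.
Proof.
apply/seteqP; split => z; rewrite /upper_half_plane /= in_itv /= andbT => //.
by case.
Qed.

Lemma measurable_upper_half_plane : measurable H.
Proof. by rewrite upper_half_planeE; apply: measurableX. Qed.

Local Open Scope ereal_scope.

Lemma integral_dV (f : plane -> \bar R) : measurable_fun H f ->
  (forall z, H z -> 0 <= f z) ->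
  \int[dV]_(z in H) f z =
  \int[leb]_(y in `]0%R, +oo[) \int[leb]_(x in [set: R]) f (x, y).
Proof.
rewrite upper_half_planeE => mf f0.
exact: (@integral_prod_on _ _ _ _ R leb leb).
Qed.

(** The factors come from the comparison of D with half of |x - u| + y + v,
    from the integral in u, and from the integral in v. *)
Definition kernel_constant (m n : R) : R :=
  (2 `^ n * (2 / (n - 1)) * ((m + 1)^-1 + (n - m - 2)^-1))%R.

Lemma kernel_constant_ge0 (m n : R) : (-1 < m)%R -> (m + 2 < n)%R ->
  (0 <= kernel_constant m n)%R.
Proof.
move=> m1 mn; apply: mulr_ge0; last by rewrite addr_ge0// invr_ge0; lra.
by apply: mulr_ge0; [exact: powR_ge0|rewrite divr_ge0//; lra].
Qed.

(** The exponent of y is forced by homogeneity; m > -1 gives convergence at the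
    real axis and n > m + 2 convergence at infinity. *)
Lemma integral_kernel_le (m n : R) (z : plane) :
  (-1 < m)%R -> (m + 2 < n)%R -> H z ->
  \int[dV]_(w in H) ((w.2 : R) `^ m * reflected_dist z w `^ (- n))%:E <=
  (kernel_constant m n * (z.2 : R) `^ (m + 2 - n))%:E.
Proof.
move=> m1 mn Hz; have z0 : (0 < (z.2 : R))%R by [].
have n1 : (1 < n)%R by lra.
have mk : measurable_fun [set: plane]
    (fun w => ((w.2 : R) `^ m * reflected_dist z w `^ (- n))%:E).
  apply/measurable_EFinP; apply: measurable_funM.
    apply: measurable_powR_fun; exact: measurable_im.
  apply: measurable_powR_fun.
  exact: (measurable_fun_pair2 z measurable_reflected_dist).
rewrite integral_dV; last 2 first.
- exact: measurable_funTS.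
- by move=> w _; rewrite lee_fin mulr_ge0 ?powR_ge0.
pose K := (2 `^ n * (2 / (n - 1)))%R.
have K0 : (0 <= K)%R.
  by apply: mulr_ge0; [exact: powR_ge0|rewrite divr_ge0//; lra].
have mv : measurable_fun (`]0%R, +oo[%classic : set (measurableTypeR R)) (fun v : measurableTypeR R =>
    (v `^ m * (v + (z.2 : R)) `^ (1 - n))%:E).
  apply: measurable_funTS; apply/measurable_EFinP; apply: measurable_funM.
    exact: measurable_powR.
  apply: measurable_powR_fun; exact: measurable_funD.
apply: (@le_trans _ _ (\int[leb]_(v in `]0%R, +oo[)
    (K%:E * (v `^ m * (v + (z.2 : R)) `^ (1 - n))%:E))).
  apply: ge0_le_integral => //.
  - move=> v _; apply: integral_ge0 => u _; by rewrite lee_fin mulr_ge0 ?powR_ge0.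
  - apply: measurable_funTS.
    apply: (measurable_fun_fubini_tonelli_G (m1 := leb) _ mk).
    by move=> w; rewrite lee_fin mulr_ge0 ?powR_ge0.
  - exact: emeasurable_funM.
  - move=> v /=; rewrite in_itv/= andbT => v0.
    have s0 : (0 < v + z.2)%R by rewrite addr_gt0.
    have k1 : (- n < -1)%R by lra.
    have L := integral_powR_line (z.1 : R) k1 s0.
    apply: (@le_trans _ _ ((v `^ m * 2 `^ n)%:E *
      \int[leb]_(u in [set: R]) ((`|(z.1 : R) - u| + (v + z.2)) `^ (- n))%:E)).
      have ml : measurable_fun [set: measurableTypeR R] (fun u : measurableTypeR R =>
          ((`|(z.1 : R) - u| + (v + z.2)) `^ (- n))%:E).
        apply/measurable_EFinP; apply: measurable_powR_fun.
        apply: measurable_funD => //; apply: measurableT_comp => //.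
        exact: measurable_funB.
      rewrite -ge0_integralZl_EFin ?mulr_ge0 ?powR_ge0//; last first.
        by move=> u _; rewrite lee_fin powR_ge0.
      apply: ge0_le_integral => //.
      + by move=> u _; rewrite lee_fin mulr_ge0 ?powR_ge0.
      + exact: (measurable_fun_pair1 v mk).
      + exact: emeasurable_funM.
      + move=> u _; rewrite -EFinM lee_fin -mulrA ler_wpM2l ?powR_ge0//.
        have Hw : H (u, v) by [].
        have := reflected_dist_ge Hz Hw; rewrite /= (addrC (z.2 : R)) => D.
        have D0 := reflected_dist_gt0 Hz Hw.
        have S0 : (0 < `|(z.1 : R) - u| + (v + z.2))%R by rewrite ltr_wpDl.
        have -> : (2 `^ n = (2^-1) `^ (- n) :> R)%R.
          by rewrite -[(2^-1)%R]powR_inv1// -powRrM mulrNN mul1r.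
        rewrite -powRM ?invr_ge0//; last exact: ltW.
        apply: ler_powRN.
        * by rewrite mulr_gt0 ?invr_gt0.
        * by rewrite ler_pdivrMl.
        * lra.
    apply: (le_trans (lee_wpmul2l _ L)); first by rewrite lee_fin mulr_ge0 ?powR_ge0.
    rewrite -!EFinM lee_fin le_eqVlt; apply/orP; left; apply/eqP.
    rewrite /K [(- n + 1)%R]addrC; have -> : (- (1 - n) = n - 1)%R by ring.
    ring.
rewrite ge0_integralZl_EFin//; last first.
  by move=> v _; rewrite lee_fin mulr_ge0 ?powR_ge0.
have mk1 : (m + (1 - n) < -1)%R by lra.
apply: (le_trans (lee_wpmul2l _ (integral_powR_halfline m1 mk1 z0))).
  by rewrite lee_fin.
rewrite -EFinM lee_fin le_eqVlt; apply/orP; left; apply/eqP.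
rewrite /kernel_constant /K !mulrA; congr (_ * _ * _)%R.
- congr (_ + _^-1)%R; ring.
- congr (_ `^ _)%R; ring.
Qed.

Local Close Scope ereal_scope.

Definition Tplus_kernel (a b : R) (z w : plane) : R :=
  reflected_dist z w `^ (- (1 + b)) * (w.2 : R) `^ a.

Lemma Tplus_kernel_ge0 (a b : R) (z w : plane) : 0 <= Tplus_kernel a b z w.
Proof. by rewrite mulr_ge0 ?powR_ge0. Qed.

Lemma measurable_Tplus_kernel (a b : R) (D : set (plane * plane)) :
  measurable_fun D (fun zw => Tplus_kernel a b zw.1 zw.2).
Proof.
apply: measurable_funTS; apply: measurable_funM; apply: measurable_powR_fun.
  exact: measurable_reflected_dist.
by apply: (measurableT_comp (measurable_im : measurable_fun _ (fun z : plane => z.2 : R))).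
Qed.

Lemma measurable_Tplus_kernel1 (a b : R) (D : set plane) (z : plane) :
  measurable_fun D (Tplus_kernel a b z).
Proof.
apply: measurable_funTS.
exact: (measurable_fun_pair2 z (measurable_Tplus_kernel a b (D := setT))).
Qed.

Local Open Scope ereal_scope.

(** The operator with absolute values inside.  Extended real values allow it to
    be bounded before any convergence is known. *)
Definition positive_Tplus (a b : R) (F : plane -> R) (z : plane) : \bar R :=
  \int[dV]_(w in H) (F w * Tplus_kernel a b z w)%:E.

End upper_half_plane.

(** * Sufficiency *)

(** Choosing A proportional to r makes r < (s+t)A and sigma < (s+t)(1-A); then
    the four constraints on u = tA + c confine c to an interval whose lower end
    lo lies below its upper end hi. *)
Lemma schur_exponents (R : realType) (r sigma s t : R) :
  0 < r -> 0 < sigma -> r < t -> sigma < s ->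
  exists A u : R, [/\ r < u, u < (s + t) * A,
    sigma < s + u - (s + t) * A & s + u - (s + t) * A < (s + t) * (1 - A)].
Proof.
move=> r0 sigma0 rt sigmas.
pose A := r / (r + sigma); pose B := sigma / (r + sigma).
have rs0 : 0 < r + sigma by rewrite addr_gt0.
have AB : A + B = 1 by rewrite /A /B -mulrDl divff// gt_eqF.
have A0 : 0 < A by rewrite divr_gt0.
have B0 : 0 < B by rewrite divr_gt0.
have rE : r = A * (r + sigma) by rewrite /A divfK// gt_eqF.
have sigmaE : sigma = B * (r + sigma) by rewrite /B divfK// gt_eqF.
have f1 : r < t * A + s * A.
  rewrite {1}rE -mulrDl mulrC ltr_pM2r//; lra.
have f4 : sigma < s * B + t * B.
  rewrite {1}sigmaE -mulrDl mulrC ltr_pM2r//; lra.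
have tE : t * A + t * B = t by rewrite -mulrDr AB mulr1.
have sE : s * A + s * B = s by rewrite -mulrDr AB mulr1.
pose lo := Num.max (r - t * A) (sigma - s * B).
pose hi := Num.min (s * A) (t * B).
have lohi : lo < hi.
  by rewrite /lo /hi gt_max !lt_min; apply/andP; split; apply/andP; split; lra.
have [l1 l2] : r - t * A <= lo /\ sigma - s * B <= lo.
  by rewrite /lo !le_max !lexx orbT.
have [h1 h2] : hi <= s * A /\ hi <= t * B.
  by rewrite /hi !ge_min !lexx orbT.
exists A, (t * A + (lo + hi) / 2).
have -> : 1 - A = B by rewrite -AB addrAC subrr add0r.
by rewrite !mulrDl; split; lra.
Qed.

Section sufficiency.
Context {R : realType}.
Local Notation plane := (measurableTypeR R * measurableTypeR R)%type.
Local Notation H := (@upper_half_plane R).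
Local Notation dV := (@dV R).
Variables (a b alpha beta p q : R).
Hypotheses (hbeta : -1 < beta) (hp : 1 < p) (hpq : p <= q).
Hypotheses (hb : b = a + 1 - (alpha + 2) / p + (beta + 2) / q)
  (ha : alpha + 1 < p * (a + 1)).
Local Open Scope ereal_scope.

(** Here r = 1/p', sigma = 1/q and n = s + t; the test weight is phi(z) =
    y^kappa, the kernel is split as D^(-nA) D^(-n(1-A)), and g = F v^(alpha/p) absorbs the weight of the domain while the
    factor y^(beta/q) of P2 is the one of the target. *)
Lemma positive_Tplus_bounded : exists2 C : R, (0 <= C)%R &
  forall F : plane -> R, measurable_fun H F -> (forall z, H z -> (0 <= F z)%R) ->
  \int[dV]_(z in H) (positive_Tplus a b F z `^ q * ((z.2 : R) `^ beta)%:E) <=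
  C%:E * (\int[dV]_(w in H) (F w `^ p * (w.2 : R) `^ alpha)%:E) `^ (q / p).
Proof.
have p0 : (0 < p)%R by exact: lt_trans hp.
have q0 : (0 < q)%R by exact: lt_le_trans hpq.
pose p' := (p / (p - 1))%R.
have p'0 : (0 < p')%R by rewrite divr_gt0// subr_gt0.
pose r := (1 - p^-1)%R; pose sigma := (q^-1)%R.
pose s := ((beta + 2) / q)%R; pose t := (a + 2 - (alpha + 2) / p)%R.
have rp' : (r = p'^-1)%R by rewrite /r /p'; field; rewrite !gt_eqF// subr_gt0.
have r0 : (0 < r)%R by rewrite rp' invr_gt0.
have sigma0 : (0 < sigma)%R by rewrite invr_gt0.
have rt : (r < t)%R.
  rewrite -subr_gt0; have -> : (t - r = (p * (a + 1) - (alpha + 1)) / p)%R.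
    by rewrite /t /r; field; rewrite gt_eqF.
  by rewrite divr_gt0// subr_gt0.
have sigmas : (sigma < s)%R.
  rewrite /s /sigma -[ltLHS]mul1r ltr_pM2r ?invr_gt0//; move: hbeta; lra.
have nE : (s + t = 1 + b)%R by rewrite hb /s /t; ring.
have [A [u []]] := schur_exponents r0 sigma0 rt sigmas.
rewrite nE; set n := (1 + b)%R => u1 u2 u3 u4.
(* The power e1 of v in P1 is such that m1 = e1 p' and n1 are the exponents of
   the first test integral; m2 and n2 are those of the second. *)
pose e1 := (u - 2 * r)%R; pose kappa := (u - n * A)%R.
pose e2 := (a - alpha / p - e1)%R.
pose m1 := (e1 * p')%R; pose n1 := (n * A * p')%R.
pose m2 := (beta + q * kappa)%R; pose n2 := (n * (1 - A) * q)%R.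
have m1_gt : (-1 < m1)%R.
  have -> : (-1 = - r * p')%R by rewrite rp' mulNr mulVf// gt_eqF.
  by rewrite ltr_pM2r// /e1; lra.
have n1_gt : (m1 + 2 < n1)%R.
  have -> : (m1 + 2 = u * p')%R.
    by rewrite /m1 /e1 rp'; field; rewrite gt_eqF.
  by rewrite ltr_pM2r.
have m2E : (m2 + 2 = (s + u - n * A) * q)%R.
  by rewrite /m2 /kappa /s; field; rewrite gt_eqF.
have m2_gt : (-1 < m2)%R.
  suff : (1 < m2 + 2)%R by lra.
  by rewrite m2E -ltr_pdivrMr// mul1r.
have n2_gt : (m2 + 2 < n2)%R by rewrite m2E ltr_pM2r.
pose C1 := kernel_constant m1 n1; pose C2 := kernel_constant m2 n2.
have C10 : (0 <= C1)%R by exact: kernel_constant_ge0.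
have C20 : (0 <= C2)%R by exact: kernel_constant_ge0.
exists (C1 `^ (q / p') * C2)%R; first by rewrite mulr_ge0 ?powR_ge0.
move=> F mF F0.
have imD (D : set plane) (k : R) :
    measurable_fun D (fun z : plane => (z.2 : R) `^ k)%R.
  by apply: measurable_funTS; apply: measurable_powR_fun; exact: measurable_im.
have im1 (D : set (plane * plane)) (k : R) :
    measurable_fun D (fun zw : plane * plane => (zw.1.2 : R) `^ k)%R.
  apply: measurable_funTS; apply: measurable_powR_fun.
  by apply: (measurableT_comp (measurable_im : measurable_fun _ (fun z : plane => z.2 : R))).
have im2 (D : set (plane * plane)) (k : R) :
    measurable_fun D (fun zw : plane * plane => (zw.2.2 : R) `^ k)%R.
  apply: measurable_funTS; apply: measurable_powR_fun.
  by apply: (measurableT_comp (measurable_im : measurable_fun _ (fun z : plane => z.2 : R))).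
have md (D : set (plane * plane)) (k : R) :
    measurable_fun D (fun zw => reflected_dist zw.1 zw.2 `^ k)%R.
  by apply: measurable_funTS; apply: measurable_powR_fun; exact: measurable_reflected_dist.
pose P1 (zw : plane * plane) :=
  ((zw.2.2 : R) `^ e1 * reflected_dist zw.1 zw.2 `^ (- (n * A)))%R.
pose P2 (zw : plane * plane) :=
  ((zw.1.2 : R) `^ (beta / q) *
   ((zw.2.2 : R) `^ e2 * reflected_dist zw.1 zw.2 `^ (- (n * (1 - A)))))%R.
pose g (w : plane) := (F w * (w.2 : R) `^ (alpha / p))%R.
pose phi (z : plane) := ((z.2 : R) `^ kappa)%R.
have test1 z : H z -> \int[dV]_(w in H) (P1 (z, w) `^ p')%:E <=
    (C1 * phi z `^ p')%:E.
  move=> Hz; have := integral_kernel_le m1_gt n1_gt Hz.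
  have -> : (m1 + 2 - n1 = kappa * p')%R.
    by rewrite /m1 /n1 /e1 /kappa rp'; field; rewrite gt_eqF.
  rewrite powRrM; apply: le_trans; rewrite le_eqVlt; apply/orP; left; apply/eqP.
  apply: eq_integral => w _.
  by rewrite /P1 /= powRM ?powR_ge0// -!powRrM mulNr.
have test2 w : H w -> \int[dV]_(z in H) ((phi z * P2 (z, w)) `^ q)%:E <= C2%:E.
  move=> Hw; have w0 : (0 < (w.2 : R))%R by [].
  have ml : measurable_fun H
      (fun z => ((z.2 : R) `^ m2 * reflected_dist w z `^ (- n2))%:E).
    apply/measurable_EFinP; apply: measurable_funM => //.
    apply: measurable_funTS; apply: measurable_powR_fun.
    exact: (measurable_fun_pair2 w measurable_reflected_dist).
  have -> : \int[dV]_(z in H) ((phi z * P2 (z, w)) `^ q)%:E =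
      ((w.2 : R) `^ (e2 * q))%:E *
      \int[dV]_(z in H) ((z.2 : R) `^ m2 * reflected_dist w z `^ (- n2))%:E.
    rewrite -ge0_integralZl_EFin ?powR_ge0//; last 2 first.
    - exact: measurable_upper_half_plane.
    - by move=> z _; rewrite lee_fin mulr_ge0 ?powR_ge0.
    apply: eq_integral => z; rewrite inE => Hz; rewrite -EFinM; congr EFin.
    have z0 : (0 < (z.2 : R))%R by [].
    rewrite /phi /P2 /= !powRM ?mulr_ge0 ?powR_ge0// -!powRrM (reflected_distC w).
    have -> : (m2 = kappa * q + beta / q * q)%R.
      by rewrite /m2 divfK ?gt_eqF// mulrC addrC.
    rewrite powRD; last by apply/implyP => _; rewrite gt_eqF.
    by rewrite /n2 mulNr; ring.
  apply: (le_trans (lee_wpmul2l _ (integral_kernel_le m2_gt n2_gt Hw))).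
    by rewrite lee_fin powR_ge0.
  rewrite -EFinM lee_fin mulrCA -powRD; last by apply/implyP => _; rewrite gt_eqF.
  have -> : (e2 * q + (m2 + 2 - n2) = 0)%R.
    have -> : (n2 = q * (s + t - n * A))%R by rewrite /n2 nE -/n; ring.
    rewrite m2E /e2 /e1 /s /t /r; field.
    by rewrite !gt_eqF.
  by rewrite powRr0 mulr1.
have mg : measurable_fun H g by apply: measurable_funM.
have mP1 : measurable_fun (H `*` H) P1 by apply: measurable_funM.
have mP2 : measurable_fun (H `*` H) P2.
  by apply: measurable_funM => //; apply: measurable_funM.
have mH := measurable_upper_half_plane (R := R).
have := @schur_test _ _ plane plane R (@area R) (@area R) H H P1 P2 g phi
  p q C1 C2 hp hpq C10 C20 mH mH mP1 mP2 mg (imD _ _) _ _ _ _ test1 test2.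
have -> : \int[dV]_(w in H) (F w `^ p * (w.2 : R) `^ alpha)%:E =
    \int[dV]_(w in H) (g w `^ p)%:E.
  apply: eq_integral => w; rewrite inE => Hw.
  by rewrite /g powRM ?F0 ?powR_ge0// -powRrM divfK// gt_eqF.
have -> : \int[dV]_(z in H) (positive_Tplus a b F z `^ q * ((z.2 : R) `^ beta)%:E) =
    \int[dV]_(z in H) ((\int[dV]_(w in H) (P1 (z, w) * P2 (z, w) * g w)%:E) `^ q).
  apply: eq_integral => z; rewrite inE => Hz.
  have z0 : (0 < (z.2 : R))%R by [].
  have -> : \int[dV]_(w in H) (P1 (z, w) * P2 (z, w) * g w)%:E =
     ((z.2 : R) `^ (beta / q))%:E * positive_Tplus a b F z.
    rewrite -ge0_integralZl_EFin ?powR_ge0//; last 2 first.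
    - by move=> w Hw; rewrite lee_fin !mulr_ge0 ?powR_ge0 ?F0.
    - apply/measurable_EFinP; apply: measurable_funM => //.
      apply: measurable_funM => //.
      apply: measurable_funTS; apply: measurable_powR_fun.
      exact: (measurable_fun_pair2 z measurable_reflected_dist).
    apply: eq_integral => w; rewrite inE => Hw; rewrite -EFinM; congr EFin.
    have w0 : (0 < (w.2 : R))%R by [].
    have d0 := reflected_dist_gt0 Hz Hw.
    rewrite /P1 /P2 /g /Tplus_kernel /=.
    have -> : (- (1 + b) = - (n * A) + - (n * (1 - A)))%R by rewrite /n; ring.
    have -> : (a = e1 + e2 + alpha / p)%R by rewrite /e2; ring.
    rewrite !powRD; try by apply/implyP => _; rewrite gt_eqF.
    ring.
  rewrite poweRM ?lee_fin ?powR_ge0//; last first.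
    by apply: integral_ge0 => w Hw; rewrite lee_fin !mulr_ge0 ?powR_ge0 ?F0.
  by rewrite poweR_EFin -powRrM divfK ?gt_eqF// muleC.
apply.
- by move=> zw _; rewrite mulr_ge0 ?powR_ge0.
- by move=> zw _; rewrite !mulr_ge0 ?powR_ge0.
- by move=> w Hw; rewrite mulr_ge0 ?powR_ge0 ?F0.
- by move=> z _; exact: powR_ge0.
Qed.

End sufficiency.

(** A divergent integral, which [Rintegral] sends to 0, obeys the bound too. *)
Lemma normr_Rintegral_le d (T : measurableType d) (R : realType)
    (mu : {measure set T -> \bar R}) (D : set T) (f : T -> R) :
  measurable D -> measurable_fun D f ->
  (`|Rintegral mu D f|%:E <= \int[mu]_(x in D) `|f x|%:E)%E.
Proof.
move=> mD mf; rewrite /Rintegral.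
apply: (@le_trans _ _ `|(\int[mu]_(x in D) (f x)%:E)|%E).
  by case: (\int[mu]_(x in D) (f x)%:E)%E => [r| |] /=; rewrite ?normr0 ?leey.
have := @le_abse_integral _ T R mu D (EFin \o f) mD.
by apply; exact/measurable_EFinP.
Qed.

Lemma measurable_Rintegral_on d1 d2 (T1 : measurableType d1)
    (T2 : measurableType d2) (R : realType)
    (m2 : {sigma_finite_measure set T2 -> \bar R})
    (D1 : set T1) (D2 : set T2) (f : T1 * T2 -> R) :
  measurable D1 -> measurable D2 -> measurable_fun (D1 `*` D2) f ->
  measurable_fun D1 (fun x => Rintegral m2 D2 (fun y => f (x, y))).
Proof.
move=> mD1 mD2 mf; apply: (measurableT_comp (fine_measurable measurableT)).
under eq_fun do rewrite integralE.
have mEf : measurable_fun (D1 `*` D2) (EFin \o f) by exact/measurable_EFinP.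
apply: emeasurable_funB.
  apply: eq_measurable_fun (measurable_integral_on m2 mD1 mD2
    (measurable_funepos mEf) (fun z _ => funepos_ge0 _ z)) => x _.
  by apply: eq_integral => y _; rewrite !funeposE.
apply: eq_measurable_fun (measurable_integral_on m2 mD1 mD2
  (measurable_funeneg mEf) (fun z _ => funeneg_ge0 _ z)) => x _.
by apply: eq_integral => y _; rewrite !funenegE.
Qed.

Section complex_facts.
Context {R : realType}.

Lemma normr_Re_le (c : R[i]) : `|complex.Re c| <= complex_modulus c.
Proof.
case: c => x y /=; rewrite /complex_modulus /=.
by rewrite -sqrtr_sqr ler_wsqrtr// lerDl sqr_ge0.
Qed.

Lemma normr_Im_le (c : R[i]) : `|complex.Im c| <= complex_modulus c.
Proof.
case: c => x y /=; rewrite /complex_modulus /=.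
by rewrite -sqrtr_sqr ler_wsqrtr// lerDr sqr_ge0.
Qed.

Lemma complex_modulus_le (c : R[i]) :
  complex_modulus c <= `|complex.Re c| + `|complex.Im c|.
Proof.
case: c => x y /=; rewrite /complex_modulus /=.
rewrite -[leRHS]ger0_norm ?addr_ge0// -sqrtr_sqr ler_wsqrtr//.
rewrite -(real_normK (num_real x)) -(real_normK (num_real y)) [leRHS]sqrrD lerD2r.
by rewrite lerDl mulrn_wge0// mulr_ge0.
Qed.

Lemma complex_modulus_ge0 (c : R[i]) : 0 <= complex_modulus c.
Proof. exact: le_trans (normr_Re_le c). Qed.

Lemma complex_modulus_real (x : R) : complex_modulus x%:C%C = `|x|.
Proof. by rewrite /complex_modulus /= expr0n addr0 sqrtr_sqr. Qed.

Lemma measurable_complex_modulus d (T : measurableType d) (D : set T)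
    (f : T -> R[i]) :
  measurable_fun D (fun x => complex.Re (f x)) ->
  measurable_fun D (fun x => complex.Im (f x)) ->
  measurable_fun D (fun x => complex_modulus (f x)).
Proof.
move=> mRe mIm.
have -> : (fun x => complex_modulus (f x)) = (fun x =>
    (complex.Re (f x) ^+ 2 + complex.Im (f x) ^+ 2) `^ 2^-1).
  apply/funext => x; rewrite powR12_sqrt ?addr_ge0 ?sqr_ge0//.
  by rewrite /complex_modulus; case: (f x).
by apply: measurable_powR_fun; apply: measurable_funD; exact: measurable_funX.
Qed.

End complex_facts.

Section Tplus.
Context {R : realType}.
Local Notation plane := (measurableTypeR R * measurableTypeR R)%type.
Local Notation H := (@upper_half_plane R).
Local Notation dV := (@dV R).

Lemma Tplus_integrandE (a b : R) (f : plane -> R[i]) (z w : plane) :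
  Tplus_integrand a b f z w = (Tplus_kernel a b z w)%:C%C * f w.
Proof.
rewrite /Tplus_integrand /Tplus_kernel -/(reflected_dist z w) powRN.
rewrite [RHS]mulrC (rmorphM (real_complex R)) (fmorphV (real_complex R)).
by rewrite mulrA.
Qed.

Lemma Re_Tplus_integrand (a b : R) (f : plane -> R[i]) (z w : plane) :
  complex.Re (Tplus_integrand a b f z w) =
  Tplus_kernel a b z w * complex.Re (f w).
Proof. by rewrite Tplus_integrandE; case: (f w) => x y /=; rewrite mul0r subr0. Qed.

Lemma Im_Tplus_integrand (a b : R) (f : plane -> R[i]) (z w : plane) :
  complex.Im (Tplus_integrand a b f z w) =
  Tplus_kernel a b z w * complex.Im (f w).
Proof. by rewrite Tplus_integrandE; case: (f w) => x y /=; rewrite mul0r addr0. Qed.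

Variables (a b alpha beta p q : R).
Hypotheses (hp : 1 < p) (hpq : p <= q).

Section pointwise.
Variable f : plane -> R[i].
Hypothesis mf : complex_measurable H f.
Let F (w : plane) : R := complex_modulus (f w).

Let mH := measurable_upper_half_plane (R := R).

Let mF : measurable_fun H F.
Proof. by case: mf; exact: measurable_complex_modulus. Qed.

Let mI z : measurable_fun H (fun w => (F w * Tplus_kernel a b z w)%:E).
Proof.
by apply/measurable_EFinP; apply: measurable_funM => //; exact: measurable_Tplus_kernel1.
Qed.

Let mRe z : measurable_fun H (fun w => complex.Re (Tplus_integrand a b f z w)).
Proof.
under eq_fun do rewrite Re_Tplus_integrand.
by apply: measurable_funM; [exact: measurable_Tplus_kernel1|case: mf].
Qed.

Let mIm z : measurable_fun H (fun w => complex.Im (Tplus_integrand a b f z w)).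
Proof.
under eq_fun do rewrite Im_Tplus_integrand.
by apply: measurable_funM; [exact: measurable_Tplus_kernel1|case: mf].
Qed.

Local Open Scope ereal_scope.

Let le_Re z : \int[dV]_(w in H) `|complex.Re (Tplus_integrand a b f z w)|%:E <=
  positive_Tplus a b F z.
Proof.
apply: ge0_le_integral => //.
- by apply/measurable_EFinP; exact: measurableT_comp.
- move=> w _; rewrite lee_fin Re_Tplus_integrand normrM mulrC.
  by rewrite (ger0_norm (Tplus_kernel_ge0 _ _ _ _)) ler_wpM2r ?Tplus_kernel_ge0// normr_Re_le.
Qed.

Let le_Im z : \int[dV]_(w in H) `|complex.Im (Tplus_integrand a b f z w)|%:E <=
  positive_Tplus a b F z.
Proof.
apply: ge0_le_integral => //.
- by apply/measurable_EFinP; exact: measurableT_comp.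
- move=> w _; rewrite lee_fin Im_Tplus_integrand normrM mulrC.
  by rewrite (ger0_norm (Tplus_kernel_ge0 _ _ _ _)) ler_wpM2r ?Tplus_kernel_ge0// normr_Im_le.
Qed.

Lemma Tplus_integrable z : positive_Tplus a b F z < +oo ->
  complex_integrable H (Tplus_integrand a b f z).
Proof.
move=> fin; split; apply/integrableP; split; try exact/measurable_EFinP.
  exact: le_lt_trans (le_Re z) fin.
exact: le_lt_trans (le_Im z) fin.
Qed.

Lemma Tplus_le z :
  (complex_modulus (Tplus a b f z))%:E <= 2%:E * positive_Tplus a b F z.
Proof.
apply: (le_trans (_ : _ <= (`|complex.Re (Tplus a b f z)| +
  `|complex.Im (Tplus a b f z)|)%:E)).
  by rewrite lee_fin complex_modulus_le.
rewrite EFinD (_ : 2%:E = 1 + 1)// ge0_muleDl// mul1e; apply: leeD => /=.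
  by apply: le_trans (le_Re z); exact: normr_Rintegral_le.
by apply: le_trans (le_Im z); exact: normr_Rintegral_le.
Qed.

Lemma measurable_Tplus : complex_measurable H (Tplus a b f).
Proof.
have mf2 (h : plane -> R) : measurable_fun H h ->
    measurable_fun (H `*` H) (fun zw => Tplus_kernel a b zw.1 zw.2 * h zw.2)%R.
  move=> mh; apply: measurable_funM; first exact: measurable_Tplus_kernel.
  apply: (@measurable_comp _ _ _ _ _ _ H h (H `*` H) snd) => //.
  - by move=> _ [z [_ ?] <-].
  - exact: measurable_funTS.
have [mRef mImf] := mf.
split; rewrite /Tplus /complex_integral /=.
  have := measurable_Rintegral_on (@area R) mH mH (mf2 _ mRef).
  apply: eq_measurable_fun => z _; apply: eq_Rintegral => w _.
  by rewrite Re_Tplus_integrand.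
have := measurable_Rintegral_on (@area R) mH mH (mf2 _ mImf).
apply: eq_measurable_fun => z _; apply: eq_Rintegral => w _.
by rewrite Im_Tplus_integrand.
Qed.

End pointwise.

(** Boundedness of the positive operator makes it finite almost everywhere, and
    the real and imaginary parts are each dominated by it; whence the factor 2
    in the constant. *)
Lemma Tplus_bounded_sufficient : (-1 < beta)%R ->
  b = (a + 1 - (alpha + 2) / p + (beta + 2) / q)%R ->
  (alpha + 1 < p * (a + 1))%R -> Tplus_bounded a b p alpha q beta.
Proof.
move=> hbeta hb ha.
have p0 : (0 < p)%R by exact: lt_trans hp.
have q0 : (0 < q)%R by exact: lt_le_trans hpq.
have mH := measurable_upper_half_plane (R := R).
have [C C0 bound] := positive_Tplus_bounded hbeta hp hpq hb ha.
exists ((2 `^ q * C) `^ q^-1)%R => f [mf Wfin].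
set W := weighted_integral p alpha f in Wfin *.
pose F (w : plane) : R := complex_modulus (f w).
have mF : measurable_fun H F by case: mf; exact: measurable_complex_modulus.
have F0 z : H z -> (0 <= F z)%R by move=> _; exact: complex_modulus_ge0.
have {}bound : (\int[dV]_(z in H)
   (positive_Tplus a b F z `^ q * ((z.2 : R) `^ beta)%:E) <= C%:E * W `^ (q / p))%E.
  exact: bound.
have W0 : (0 <= W)%E.
  by apply: integral_ge0 => z _; rewrite lee_fin mulr_ge0 ?powR_ge0.
have CWfin : (C%:E * W `^ (q / p) < +oo)%E.
  by rewrite lte_mul_pinfty// ?lee_fin// poweR_lty.
have I0 z : (0 <= positive_Tplus a b F z)%E.
  apply: integral_ge0 => w Hw.
  by rewrite lee_fin mulr_ge0 ?F0// Tplus_kernel_ge0.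
have mI : measurable_fun H (positive_Tplus a b F).
  apply: (measurable_integral_on (@area R)
    (f := fun zw => (F zw.2 * Tplus_kernel a b zw.1 zw.2)%:E) mH mH).
    apply/measurable_EFinP; apply: measurable_funM; last exact: measurable_Tplus_kernel.
    apply: (@measurable_comp _ _ _ _ _ _ H F (H `*` H) snd) => //.
    - by move=> _ [z [_ ?] <-].
    - exact: measurable_funTS.
  by move=> zw [_ ?]; rewrite lee_fin mulr_ge0 ?F0// Tplus_kernel_ge0.
have mIq : measurable_fun H
    (fun z => positive_Tplus a b F z `^ q * ((z.2 : R) `^ beta)%:E)%E.
  apply: emeasurable_funM; first exact: (measurableT_comp (measurable_poweR q)).
  apply/measurable_EFinP; apply: measurable_powR_fun; apply: measurable_funTS.
  exact: measurable_im.
have [mTRe mTIm] := measurable_Tplus mf.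
have main : (weighted_integral q beta (Tplus a b f) <=
    (2 `^ q * C)%:E * W `^ (q / p))%E.
  rewrite EFinM -muleA.
  apply: (@le_trans _ _ (\int[dV]_(z in H) ((2 `^ q)%:E *
     (positive_Tplus a b F z `^ q * ((z.2 : R) `^ beta)%:E)))%E).
    apply: ge0_le_integral => //.
    - by move=> z _; rewrite lee_fin mulr_ge0 ?powR_ge0.
    - apply/measurable_EFinP; apply: measurable_funM.
        by apply: measurable_powR_fun; exact: measurable_complex_modulus.
      by apply: measurable_powR_fun; apply: measurable_funTS; exact: measurable_im.
    - exact: emeasurable_funM.
    - move=> z _; rewrite EFinM muleA lee_wpmul2r ?lee_fin ?powR_ge0//.
      rewrite -!poweR_EFin -poweRM//.
      apply: le_poweR; [exact: ltW|by rewrite lee_fin complex_modulus_ge0|].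
      exact: Tplus_le.
  rewrite ge0_integralZl_EFin ?powR_ge0//; last first.
    by move=> z _; rewrite mule_ge0 ?poweR_ge0// lee_fin powR_ge0.
  by rewrite lee_wpmul2l// lee_fin powR_ge0.
split.
- have int : dV.-integrable H
      (fun z => positive_Tplus a b F z `^ q * ((z.2 : R) `^ beta)%:E)%E.
    apply/integrableP; split => //; apply: le_lt_trans CWfin.
    apply: le_trans bound; rewrite le_eqVlt; apply/orP; left; apply/eqP.
    apply: eq_integral => z _; rewrite gee0_abs// mule_ge0 ?poweR_ge0//.
    by rewrite lee_fin powR_ge0.
  have := integrable_ae mH int.
  apply: filterS => z /= fin Hz; apply: Tplus_integrable => //.
  have z0 : (0 < (z.2 : R))%R by [].
  move: (fin Hz); rewrite fin_numE => /andP[_] /negP ny.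
  rewrite ltey; apply/negP => /eqP Iy; apply: ny.
  by rewrite /F in Iy; rewrite Iy (poweRyr (lt0r_neq0 q0)) gt0_mulye// lte_fin powR_gt0.
- split; first exact: measurable_Tplus.
  by apply: (le_lt_trans main); rewrite EFinM -muleA lte_mul_pinfty// ?lee_fin ?powR_ge0.
- rewrite /weighted_Lnorm -/W.
  apply: (@le_trans _ _ (((2 `^ q * C)%:E * W `^ (q / p)) `^ q^-1)%E).
    apply: le_poweR; [by rewrite invr_ge0 ltW| |exact: main].
    by apply: integral_ge0 => z _; rewrite lee_fin mulr_ge0 ?powR_ge0.
  rewrite poweRM ?poweR_ge0 ?lee_fin ?mulr_ge0 ?powR_ge0// -poweRrM poweR_EFin.
  by rewrite mulrAC mulfV ?mul1r// gt_eqF.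
Qed.

End Tplus.

(** * Necessity *)

(** If r <> 0, the value t = (|M| + 1)^(1/r) violates the bound. *)
Lemma powR_bounded_eq0 (R : realType) (r M : R) :
  (forall t, 0 < t -> t `^ r <= M) -> r = 0.
Proof.
move=> rM; apply: contrapT => /eqP r0.
have M1 : 0 < `|M| + 1 by rewrite ltr_wpDl.
have := rM _ (powR_gt0 r^-1 M1).
rewrite -powRrM mulVf// (powRr1 (ltW M1)) => /le_trans /(_ (ler_norm M)).
by rewrite gerDl ler10.
Qed.

Lemma powR_comparable (R : realType) (r t x L : R) :
  0 < t -> 1 <= L -> t / L <= x <= L * t ->
  L `^ (- `|r|) * t `^ r <= x `^ r <= L `^ `|r| * t `^ r.
Proof.
move=> t0 L1 /andP[lx xL]; have L0 : 0 < L by exact: lt_le_trans L1.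
have x0 : 0 < x by rewrite (lt_le_trans _ lx)// divr_gt0.
have h : `|ln x - ln t| <= ln L.
  have h1 : ln t - ln L <= ln x.
    by rewrite -ln_div ?posrE// ler_ln ?posrE ?divr_gt0.
  have h2 : ln x <= ln L + ln t.
    by rewrite -lnM ?posrE// ler_ln ?posrE ?mulr_gt0.
  by rewrite ler_norml; apply/andP; split; lra.
have {}h : `|r * (ln x - ln t)| <= `|r| * ln L by rewrite normrM ler_wpM2l.
rewrite !powRE_gt0// -!expRD !ler_expR; move: h; rewrite ler_norml => /andP[].
by move=> h1 h2; apply/andP; split; lra.
Qed.

Section necessity.
Context {R : realType}.
Local Notation plane := (measurableTypeR R * measurableTypeR R)%type.
Local Notation leb := (@lebesgue_measure R).
Local Notation H := (@upper_half_plane R).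
Local Notation dV := (@dV R).
Variables (a b alpha beta p q : R).
Hypotheses (hp : 1 < p) (hpq : p <= q).
Let p0 : 0 < p. Proof. exact: lt_trans hp. Qed.
Let q0 : 0 < q. Proof. exact: lt_le_trans hpq. Qed.
Let mH := measurable_upper_half_plane (R := R).

Local Open Scope ereal_scope.

(** Boundedness applied to g extended by zero off B: the image is at least m on
    E, a set of area e on which y^beta >= k, and the norm of g is at most
    w^(1/p).  The almost everywhere convergence in the definition of
    boundedness guarantees that the image there is a genuine integral. *)
Lemma test_inequality : Tplus_bounded a b p alpha q beta ->
  exists2 C : R, (0 <= C)%R &
  forall (B E : set plane) (g : plane -> R) (m k e w : R),
    measurable B -> B `<=` H -> measurable E -> E `<=` H ->
    measurable_fun B g -> (forall z, B z -> (0 <= g z)%R) ->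
    (0 <= m)%R -> (0 <= k)%R -> dV E = e%:E ->
    (forall z, E z -> (k <= (z.2 : R) `^ beta)%R) ->
    (forall z, E z -> m%:E <= \int[dV]_(w in B) (g w * Tplus_kernel a b z w)%:E) ->
    \int[dV]_(w in B) (g w `^ p * (w.2 : R) `^ alpha)%:E <= w%:E ->
  (m * (k * e) `^ q^-1 <= C * w `^ p^-1)%R.
Proof.
move=> [C Cbd]; exists `|C|%R => // B E g m k e w mB BH mE EH mg g0 m0 k0 eE kE mI wI.
pose h := g \_ B; pose f (z : plane) := (h z)%:C%C.
have h0 z : (0 <= h z)%R.
  by rewrite /h patchE; case: ifPn => // /set_mem; exact: g0.
have mh : measurable_fun [set: plane] h by exact/(measurable_restrictT g).
have mf : complex_measurable H f.
  by split => /=; [exact: measurable_funTS|exact: measurable_cst].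
have KE z : (fun w => complex.Re (Tplus_integrand a b f z w)) =
    (fun w => g w * Tplus_kernel a b z w)%R \_ B.
  apply/funext => u; rewrite Re_Tplus_integrand /= /h !patchE mulrC.
  by case: ifPn => // _; rewrite mul0r.
have fE z : complex_modulus (f z) = h z.
  by rewrite complex_modulus_real ger0_norm.
have intB (G : plane -> R) (F : plane -> R) : F = G \_ B ->
    \int[dV]_(z in H) (F z)%:E = \int[dV]_(z in B) (G z)%:E.
  move=> ->; rewrite -[in RHS](setIidr BH) [RHS]integral_mkcondr.
  by apply: eq_integral => z _; rewrite restrict_EFin.
have WE : weighted_integral p alpha f =
    \int[dV]_(w in B) (g w `^ p * (w.2 : R) `^ alpha)%:E.
  rewrite /weighted_integral; apply: intB; apply/funext => z.
  rewrite fE /h !patchE; case: ifPn => // _.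
  by rewrite powR0 ?mul0r// gt_eqF.
clear fE.
have W0 : 0 <= weighted_integral p alpha f.
  by apply: integral_ge0 => z _; rewrite lee_fin mulr_ge0 ?powR_ge0.
have fL : weighted_Lspace p alpha f.
  by split; [exact: mf|rewrite WE; exact: le_lt_trans wI (ltry _)].
have wI' : weighted_integral p alpha f <= w%:E by rewrite WE; exact: wI.
have w0 : (0 <= w)%R by rewrite -lee_fin; exact: le_trans W0 wI'.
have [aeint _ norm_le] := Cbd _ fL.
clear WE Cbd fL.
have e0 : (0 <= e)%R by rewrite -lee_fin -eE.
have ReT z : complex.Re (Tplus a b f z) =
    fine (\int[dV]_(w in B) (g w * Tplus_kernel a b z w)%:E).
  have -> : complex.Re (Tplus a b f z) =
    Rintegral dV H (fun w => complex.Re (Tplus_integrand a b f z w)) by [].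
  by rewrite /Rintegral; congr fine; exact: (intB _ _ (KE z)).
have aele : {ae dV, forall z, E z -> (m `^ q * k)%:E <=
    (complex_modulus (Tplus a b f z) `^ q * (z.2 : R) `^ beta)%:E}.
  apply: filterS aeint => z /= zint Ez.
  have [intRe _] := zint (EH _ Ez).
  have IE : \int[dV]_(w in H) (complex.Re (Tplus_integrand a b f z w))%:E =
     \int[dV]_(w in B) (g w * Tplus_kernel a b z w)%:E.
    exact: (intB _ _ (KE z)).
  have Ifin := integrable_fin_num mH intRe; rewrite IE in Ifin.
  have mle : (m <= complex_modulus (Tplus a b f z))%R.
    apply: le_trans (normr_Re_le _); apply: le_trans (ler_norm _).
    by rewrite ReT -lee_fin (fineK Ifin); exact: mI.
  clear ReT KE intB IE.
  rewrite lee_fin; apply: ler_pM; rewrite ?powR_ge0 ?kE//.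
  by apply: (ge0_ler_powR (ltW q0)); rewrite ?nnegrE ?complex_modulus_ge0.
clear ReT KE intB.
have [mTRe mTIm] := measurable_Tplus a b mf.
have mTq : measurable_fun H (fun z =>
    (complex_modulus (Tplus a b f z) `^ q * (z.2 : R) `^ beta)%:E).
  apply/measurable_EFinP; apply: measurable_funM.
    by apply: measurable_powR_fun; exact: measurable_complex_modulus.
  by apply: measurable_powR_fun; apply: measurable_funTS; exact: measurable_im.
have lower : (m `^ q * k * e)%:E <= weighted_integral q beta (Tplus a b f).
  rewrite EFinM -eE -(integral_cst _ mE).
  apply: (@le_trans _ _ (\int[dV]_(z in E)
     (complex_modulus (Tplus a b f z) `^ q * (z.2 : R) `^ beta)%:E)).
    apply: ae_ge0_le_integral => //.
    - by move=> z _; rewrite lee_fin mulr_ge0 ?powR_ge0.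
    - by move=> z _; rewrite lee_fin mulr_ge0 ?powR_ge0.
    - exact: measurable_funS mTq.
  apply: ge0_subset_integral => //.
  by move=> z _; rewrite lee_fin mulr_ge0 ?powR_ge0.
have qV0 : (0 <= q^-1)%R by rewrite invr_ge0 ltW.
have pV0 : (0 <= p^-1)%R by rewrite invr_ge0 ltW.
have L0 : 0 <= (m `^ q * k * e)%:E by rewrite lee_fin !mulr_ge0 ?powR_ge0.
have := le_trans (le_poweR qV0 L0 lower) norm_le.
rewrite poweR_EFin -mulrA powRM ?mulr_ge0 ?powR_ge0// -powRrM mulfV ?gt_eqF// powRr1//.
move=> H1; rewrite -lee_fin (le_trans H1)// EFinM -poweR_EFin.
apply: (@le_trans _ _ (`|C|%:E * weighted_Lnorm p alpha f)).
  by apply: lee_wpmul2r; [exact: poweR_ge0|rewrite lee_fin ler_norm].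
by apply: lee_wpmul2l; [rewrite lee_fin|exact: (le_poweR pV0 W0 wI')].
Qed.

Lemma dV_rectangle (x1 x2 y1 y2 : R) : (x1 <= x2)%R -> (y1 <= y2)%R ->
  dV (`[x1, x2]%classic `*` `[y1, y2]%classic) = ((x2 - x1) * (y2 - y1))%:E.
Proof.
move=> x12 y12.
have itvE (u v : R) : (u <= v)%R -> leb `[u, v]%classic = (v - u)%:E.
  rewrite le_eqVlt => /predU1P[->|uv]; rewrite lebesgue_measure_itv/= lte_fin.
    by rewrite ltxx subrr.
  by rewrite uv -EFinB.
rewrite EFinM -(itvE _ _ x12) -(itvE _ _ y12).
exact: (@product_measure1E _ _ _ _ R leb leb _ _ (measurable_itv _)
  (measurable_itv _)).
Qed.

Lemma measurable_rectangle (x1 x2 y1 y2 : R) :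
  measurable (`[x1, x2]%classic `*` `[y1, y2]%classic : set plane).
Proof. by apply: measurableX; exact: measurable_itv. Qed.

(** On [0,t] x [t,2t] the heights and the distance D all lie between t/5 and 5t,
    so that both sides of the test inequality are powers of t up to
    constants. *)
Lemma bounded_exponent_eq : Tplus_bounded a b p alpha q beta ->
  b = (a + 1 - (alpha + 2) / p + (beta + 2) / q)%R.
Proof.
move=> /test_inequality[C C0 test].
pose L : R := 5%R; have L1 : (1 <= L)%R by rewrite /L; lra.
have L0 : (0 < L)%R by rewrite /L; lra.
pose c1 := (L `^ (- `|- (1 + b)|) * L `^ (- `|a|))%R.
pose c2 := (L `^ (- `|beta|))%R; pose c3 := (L `^ `|alpha|)%R.
have c10 : (0 < c1)%R by rewrite mulr_gt0 ?powR_gt0.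
have c20 : (0 < c2)%R by rewrite powR_gt0.
have c30 : (0 < c3)%R by rewrite powR_gt0.
pose X := (a - b + 1 + (beta + 2) / q - (alpha + 2) / p)%R.
suff : X = 0%R by rewrite /X; lra.
apply: (@powR_bounded_eq0 _ _ (C * c3 `^ p^-1 / (c1 * c2 `^ q^-1))) => t t0.
pose B := (`[0%R, t]%classic `*` `[t, (2 * t)%R]%classic) : set plane.
have mB : measurable B by exact: measurable_rectangle.
have BH : B `<=` H.
  move=> [x y] [_ /=]; rewrite in_itv/= => /andP[ty _].
  exact: lt_le_trans ty.
have t2 : (t `^ 2 = t * t)%R by rewrite (powR_mulrn 2%N (ltW t0)) expr2.
have dVB : dV B = (t `^ 2)%:E.
  rewrite dV_rectangle; [|lra|lra]; rewrite t2; congr EFin; ring.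
have powt (r s : R) : (t `^ r * t `^ s = t `^ (r + s))%R.
  by rewrite -powRD//; apply/implyP => _; rewrite gt_eqF.
have compB z r : B z -> (L `^ (- `|r|) * t `^ r <= (z.2 : R) `^ r <=
    L `^ `|r| * t `^ r)%R.
  move=> [_ /=]; rewrite in_itv/= => /andP[tz zt].
  by apply: powR_comparable => //; rewrite /L; apply/andP; split; lra.
have kernel_ge z w : B z -> B w ->
    (c1 * t `^ (a - 1 - b) <= Tplus_kernel a b z w)%R.
  move=> Bz Bw; have Hz := BH _ Bz; have Hw := BH _ Bw.
  have /andP[wa _] := compB w a Bw.
  have [dge dle] := (reflected_dist_ge Hz Hw, reflected_dist_le Hz Hw).
  move: Bz Bw => [/=]; rewrite !in_itv/= => /andP[? ?] /andP[? ?].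
  move=> [/=]; rewrite !in_itv/= => /andP[? ?] /andP[? ?].
  have xu : (`|(z.1 : R) - w.1| <= t)%R.
    by rewrite ler_norml; apply/andP; split; lra.
  have xu0 : (0 <= `|(z.1 : R) - w.1|)%R by [].
  have dcomp : (t / L <= reflected_dist z w <= L * t)%R.
    by rewrite /L; apply/andP; split; lra.
  have /andP[db _] := powR_comparable (- (1 + b)) t0 L1 dcomp.
  rewrite /c1 (_ : (a - 1 - b = - (1 + b) + a)%R); last by ring.
  rewrite -powt mulrACA; apply: ler_pM => //; by rewrite mulr_ge0 ?powR_ge0.
have m0 : (0 <= c1 * t `^ (a - b + 1))%R by rewrite mulr_ge0 ?powR_ge0// ltW.
have k0 : (0 <= c2 * t `^ beta)%R by rewrite mulr_ge0 ?powR_ge0.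
have kE z : B z -> (c2 * t `^ beta <= (z.2 : R) `^ beta)%R.
  by move=> Bz; have /andP[] := compB z beta Bz.
have mI z : B z -> (c1 * t `^ (a - b + 1))%:E <=
    \int[dV]_(w in B) (cst 1%R w * Tplus_kernel a b z w)%:E.
  move=> Bz; have -> : (c1 * t `^ (a - b + 1))%:E =
      \int[dV]_(w in B) (c1 * t `^ (a - 1 - b))%:E.
    rewrite (integral_cst _ mB) dVB -EFinM -[in RHS]mulrA powt.
    by congr (_ * _ `^ _)%:E; ring.
  apply: ge0_le_integral => //.
  - by move=> w _; rewrite lee_fin mulr_ge0 ?powR_ge0// ltW.
  - apply/measurable_EFinP; apply: measurable_funM => //.
    exact: measurable_Tplus_kernel1.
  - by move=> w Bw; rewrite lee_fin mul1r kernel_ge.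
have wI : \int[dV]_(w in B) (cst 1%R w `^ p * (w.2 : R) `^ alpha)%:E <=
    (c3 * t `^ (alpha + 2))%:E.
  have -> : (c3 * t `^ (alpha + 2))%:E = \int[dV]_(w in B) (c3 * t `^ alpha)%:E.
    by rewrite (integral_cst _ mB) dVB -EFinM -mulrA powt.
  apply: ge0_le_integral => //.
  - by move=> w _; rewrite lee_fin mulr_ge0 ?powR_ge0.
  - apply/measurable_EFinP; apply: measurable_funM.
      by apply: measurable_powR_fun; exact: measurable_cst.
    by apply: measurable_powR_fun; apply: measurable_funTS; exact: measurable_im.
  - move=> w Bw; rewrite lee_fin powR1 mul1r; by have /andP[] := compB w alpha Bw.
have := test B B (cst 1%R) _ _ _ _ mB BH mB BH (measurable_cst _)
  (fun _ _ => ler01) m0 k0 dVB kE mI wI.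
rewrite -[(c2 * _ * _)%R]mulrA powt powRM ?powR_ge0 ?(ltW c20)// -powRrM.
rewrite [((c3 * _) `^ _)%R]powRM ?powR_ge0 ?(ltW c30)// -powRrM.
rewrite mulrACA powt => H1.
rewrite ler_pdivlMr ?mulr_gt0 ?powR_gt0//.
have -> : (t `^ X = t `^ (a - b + 1 + (beta + 2) / q) / t `^ ((alpha + 2) / p))%R.
  by rewrite -powRN powt; congr (_ `^ _)%R.
by rewrite mulrAC ler_pdivrMr ?powR_gt0// mulrC -[leRHS]mulrA.
Qed.

(** The integral of v^(-1) over [0,1] x [e^(-N),1] is exactly N, and
    alpha - p (a + 1) >= -1 bounds the p-th power of the norm of v^(-a-1) there
    by the same integral; so N^(1 - 1/p) would be bounded. *)
Lemma bounded_exponent_lt : Tplus_bounded a b p alpha q beta ->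
  (alpha + 1 < p * (a + 1))%R.
Proof.
move=> /test_inequality[C C0 test]; rewrite ltNge; apply/negP => ha.
(* Here too 5 is a common bound: for z in E and w in B the distance D lies
   between 1/2 and 4, and the height of z between 1 and 2. *)
pose L : R := 5%R; have L1 : (1 <= L)%R by rewrite /L; lra.
have L0 : (0 < L)%R by rewrite /L; lra.
pose c1 := (L `^ (- `|- (1 + b)|))%R; pose c2 := (L `^ (- `|beta|))%R.
have c10 : (0 < c1)%R by rewrite powR_gt0.
have c20 : (0 < c2)%R by rewrite powR_gt0.
suff p10 : (1 - p^-1 = 0)%R.
  have := invf_lt1 p0; rewrite hp => p1; have : (p^-1 < 1)%R by rewrite p1.
  by rewrite -subr_gt0 p10 ltxx.
apply: (@powR_bounded_eq0 _ _ (C / (c1 * c2 `^ q^-1))) => N N0.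
pose eps := expR (- N); have eps0 : (0 < eps)%R by exact: expR_gt0.
have eps1 : (eps < 1)%R by rewrite /eps -expR0 ltr_expR oppr_lt0.
pose B := (`[0%R, 1%R]%classic `*` `[eps, 1%R]%classic) : set plane.
pose E := (`[0%R, 1%R]%classic `*` `[1%R, 2%R]%classic) : set plane.
have mB : measurable B by exact: measurable_rectangle.
have mE : measurable E by exact: measurable_rectangle.
have BH : B `<=` H.
  move=> [x y] [_ /=]; rewrite in_itv/= => /andP[ty _].
  exact: lt_le_trans ty.
have EH : E `<=` H.
  move=> [x y] [_ /=]; rewrite in_itv/= => /andP[ty _].
  exact: lt_le_trans ty.
have dVE : dV E = 1%:E.
  rewrite dV_rectangle; [|lra|lra]; congr EFin; ring.
have IN : \int[dV]_(w in B) ((w.2 : R) `^ (-1))%:E = N%:E.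
  have -> : \int[dV]_(w in B) ((w.2 : R) `^ (-1))%:E =
      \int[leb]_(y in `[eps, 1%R]) \int[leb]_(x in `[0%R, 1%R]) (y `^ (-1))%:E.
    apply: (@integral_prod_on _ _ _ _ R leb leb _ _
      (fun w => ((w.2 : R) `^ (-1))%:E)) => //.
    - apply/measurable_EFinP; apply: measurable_powR_fun; apply: measurable_funTS.
      exact: measurable_im.
    - by move=> w _; rewrite lee_fin powR_ge0.
  transitivity (\int[leb]_(y in `[eps, 1%R]) (y `^ (-1))%:E).
    apply: eq_integral => y _; rewrite integral_cst//= lebesgue_measure_itv/=.
    by rewrite lte_fin ltr01 oppr0 adde0 mule1.
  rewrite (@integral_itv_primitive _ _ (@ln R))//.
    by rewrite ln1 /eps expRK sub0r opprK.
  move=> y /andP[ey _]; have y0 : (0 < y)%R by exact: lt_le_trans ey.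
  split; first by rewrite (powR_inv1 (ltW y0)); exact: is_derive1_ln.
  have := @continuous_powR_shift R 0 (-1) y; rewrite addr0 => /(_ y0).
  by rewrite (_ : (fun u : R => ((u + 0) `^ (-1))%R) = (@powR R ^~ (-1))%R);
    [exact|apply/funext => u; rewrite addr0].
pose g (w : plane) := ((w.2 : R) `^ (- (a + 1)))%R.
have mim (r : R) : measurable_fun B (fun w : plane => (w.2 : R) `^ r)%R.
  by apply: measurable_powR_fun; apply: measurable_funTS; exact: measurable_im.
have m0 : (0 <= c1 * N)%R by rewrite mulr_ge0// ltW.
have kE z : E z -> (c2 <= (z.2 : R) `^ beta)%R.
  move=> [_ /=]; rewrite in_itv/= => /andP[z1 z2].
  have zc : (1 / L <= (z.2 : R) <= L * 1)%R.
    by rewrite /L; apply/andP; split; lra.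
  by have /andP[] := powR_comparable beta ltr01 L1 zc; rewrite powR1 mulr1.
have kernel_ge z w : E z -> B w ->
    (c1 * (w.2 : R) `^ (-1) <= g w * Tplus_kernel a b z w)%R.
  move=> Ez Bw; have Hz := EH _ Ez; have Hw := BH _ Bw.
  have w0 : (0 < (w.2 : R))%R by [].
  have [dge dle] := (reflected_dist_ge Hz Hw, reflected_dist_le Hz Hw).
  move: Ez Bw => [/=]; rewrite !in_itv/= => /andP[? ?] /andP[? ?].
  move=> [/=]; rewrite !in_itv/= => /andP[? ?] /andP[? ?].
  have xu : (`|(z.1 : R) - w.1| <= 1)%R.
    by rewrite ler_norml; apply/andP; split; lra.
  have xu0 : (0 <= `|(z.1 : R) - w.1|)%R by [].
  have dcomp : (1 / L <= reflected_dist z w <= L * 1)%R.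
    by rewrite /L; apply/andP; split; lra.
  have /andP[] := powR_comparable (- (1 + b)) ltr01 L1 dcomp.
  rewrite powR1 mulr1 => db _.
  rewrite /g /Tplus_kernel mulrCA -powRD; last by apply/implyP => _; rewrite gt_eqF.
  have -> : (- (a + 1) + a = -1)%R by ring.
  by rewrite ler_wpM2r ?powR_ge0.
have mI z : E z -> (c1 * N)%:E <=
    \int[dV]_(w in B) (g w * Tplus_kernel a b z w)%:E.
  move=> Ez; rewrite EFinM -IN -ge0_integralZl_EFin ?(ltW c10)//; last 2 first.
  - by move=> w _; rewrite lee_fin powR_ge0.
  - by apply/measurable_EFinP; exact: mim.
  apply: ge0_le_integral => //.
  - by move=> w _; rewrite -EFinM lee_fin mulr_ge0 ?powR_ge0// ltW.
  - by apply: emeasurable_funM => //; apply/measurable_EFinP; exact: mim.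
  - apply/measurable_EFinP; apply: measurable_funM; first exact: mim.
    exact: measurable_Tplus_kernel1.
  - by move=> w Bw; rewrite -EFinM lee_fin kernel_ge.
have wI : \int[dV]_(w in B) (g w `^ p * (w.2 : R) `^ alpha)%:E <= N%:E.
  rewrite -IN; apply: ge0_le_integral => //.
  - by move=> w _; rewrite lee_fin mulr_ge0 ?powR_ge0.
  - apply/measurable_EFinP; apply: measurable_funM; last exact: mim.
    by apply: measurable_powR_fun; exact: mim.
  - by apply/measurable_EFinP; exact: mim.
  - move=> w Bw; have w0 : (0 < (w.2 : R))%R by exact: BH.
    have w1 : ((w.2 : R) <= 1)%R by move: Bw => [_ /=]; rewrite in_itv/= => /andP[].
    rewrite lee_fin /g -powRrM -powRD; last by apply/implyP => _; rewrite gt_eqF.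
    apply: ger_powR; first by rewrite w0.
    move: ha; rewrite mulNr [(_ * p)%R]mulrC; lra.
have := test B E g _ _ _ _ mB BH mE EH (mim _) (fun _ _ => powR_ge0 _ _)
  m0 (ltW c20) dVE kE mI wI.
rewrite mulr1 => H1.
rewrite ler_pdivlMr ?mulr_gt0 ?powR_gt0//.
have -> : (N `^ (1 - p^-1) = N / N `^ p^-1)%R.
  by rewrite -powRN powRD ?powRr1 ?(ltW N0)//; apply/implyP => _; rewrite gt_eqF.
by rewrite mulrAC ler_pdivrMr ?powR_gt0// mulrA [(N * c1)%R]mulrC.
Qed.

End necessity.

Theorem theorem1p1 (R : realType) (a b alpha beta p q : R)
    (halpha : -1 < alpha) (hbeta : -1 < beta) (hp : 1 < p) (hpq : p <= q) :
  Tplus_bounded a b p alpha q beta <->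
  (b = a + 1 - (alpha + 2) / p + (beta + 2) / q /\ alpha + 1 < p * (a + 1)).
Proof.
split=> [bounded|[hb ha]]; last exact: Tplus_bounded_sufficient.
split; first exact: (bounded_exponent_eq hp hpq bounded).
exact: (bounded_exponent_lt hp hpq bounded).
Qed.
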